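(* For every $n\ge1$, the Mellin transform $\mathfrak{M}$ induces an isomorphism of $\Lambda$-modules \[ \Lambda_n\cong(\mathbb{A}^+_{\mathbb{Q}_p})^{\psi=0}\big/\varphi^n(\pi)(\mathbb{A}^+_{\mathbb{Q}_p})^{\psi=0}. \]
   Context: $p$ is an odd prime, $E/\mathbb{Q}_p$ finite with ring of integers $\mathcal{O}$. $\Gamma=\mathrm{Gal}(\mathbb{Q}(\mu_{p^\infty})/\mathbb{Q})$ with cyclotomic character $\chi$, $\Gamma_n=\mathrm{Gal}(\mathbb{Q}(\mu_{p^\infty})/\mathbb{Q}(\mu_{p^n}))$, $\Lambda=\mathcal{O}[[\Gamma]]$, $\Lambda_n=\mathcal{O}[\Gamma/\Gamma_n]$. $\mathbb{A}^+_{\mathbb{Q}_p}=\mathcal{O}[[\pi]]$ with $\mathcal{O}$-linear Frobenius $\varphi(\pi)=(1+\pi)^p-1$ and $\Gamma$-action $\sigma(\pi)=(1+\pi)^{\chi(\sigma)}-1$; $\psi$ is the left inverse of $\varphi$ with $(\varphi\circ\psi)(F)(\pi)=\frac1p\sum_{\zeta^p=1}F(\zeta(1+\pi)-1)$. The Mellin transform is the $\Lambda$-module isomorphism $\mathfrak{M}:\Lambda\to(\mathbb{A}^+_{\mathbb{Q}_p})^{\psi=0}$, $\lambda\mapsto\lambda\cdot(1+\pi)$. *)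

(* Defs.v *)
From HB Require Import structures.
From mathcomp Require Import all_boot all_order all_fingroup all_algebra all_field.
From mathcomp Require Import boolp classical_sets functions.

Set Implicit Arguments.
Unset Strict Implicit.
Unset Printing Implicit Defensive.

Import GRing.Theory.

Local Open Scope ring_scope.

Record inv_system := InvSystem {
  stage : nat -> nzRingType;
  transition : forall n, {rmorphism stage n.+1 -> stage n}
}.

Record invlim (S : inv_system) := InvLim {
  component :> forall n, stage S n;
  componentP : forall n, transition S n (component n.+1) = component n
}.

Section InvLimRing.
Variable S : inv_system.
Implicit Types x y z : invlim S.

Lemma invlim_eqP x y : (forall n, x n = y n) -> x = y.
Proof.
case: x y => [x xP] [y yP] /= e.
have {}e : x = y by apply: functional_extensionality_dep.
case: y / e yP => yP; congr InvLim; exact: Prop_irrelevance.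
Qed.

HB.instance Definition _ := gen_eqMixin (invlim S).
HB.instance Definition _ := gen_choiceMixin (invlim S).

Program Definition invlim0 := @InvLim S (fun n => 0) _.
Next Obligation. by rewrite rmorph0. Qed.
Program Definition invlim1 := @InvLim S (fun n => 1) _.
Next Obligation. by rewrite rmorph1. Qed.
Program Definition invlimN x := @InvLim S (fun n => - x n) _.
Next Obligation. by rewrite rmorphN componentP. Qed.
Program Definition invlimD x y := @InvLim S (fun n => x n + y n) _.
Next Obligation. by rewrite rmorphD !componentP. Qed.
Program Definition invlimM x y := @InvLim S (fun n => x n * y n) _.
Next Obligation. by rewrite rmorphM !componentP. Qed.

Fact invlim_addA : associative invlimD.
Proof. by move=> x y z; apply: invlim_eqP => n; apply: addrA. Qed.
Fact invlim_addC : commutative invlimD.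
Proof. by move=> x y; apply: invlim_eqP => n; apply: addrC. Qed.
Fact invlim_add0 : left_id invlim0 invlimD.
Proof. by move=> x; apply: invlim_eqP => n; apply: add0r. Qed.
Fact invlim_addN : left_inverse invlim0 invlimN invlimD.
Proof. by move=> x; apply: invlim_eqP => n; apply: addNr. Qed.
HB.instance Definition _ := GRing.isZmodule.Build (invlim S)
  invlim_addA invlim_addC invlim_add0 invlim_addN.

Fact invlim_mulA : associative invlimM.
Proof. by move=> x y z; apply: invlim_eqP => n; apply: mulrA. Qed.
Fact invlim_mul1l : left_id invlim1 invlimM.
Proof. by move=> x; apply: invlim_eqP => n; apply: mul1r. Qed.
Fact invlim_mul1r : right_id invlim1 invlimM.
Proof. by move=> x; apply: invlim_eqP => n; apply: mulr1. Qed.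
Fact invlim_mulDl : left_distributive invlimM invlimD.
Proof. by move=> x y z; apply: invlim_eqP => n; apply: mulrDl. Qed.
Fact invlim_mulDr : right_distributive invlimM invlimD.
Proof. by move=> x y z; apply: invlim_eqP => n; apply: mulrDr. Qed.
Fact invlim_neq0 : invlim1 != invlim0.
Proof.
apply/eqP => /(congr1 (fun x : invlim S => x 0%N)) /eqP.
by rewrite /= oner_eq0.
Qed.
HB.instance Definition _ := GRing.Zmodule_isNzRing.Build (invlim S)
  invlim_mulA invlim_mul1l invlim_mul1r invlim_mulDl invlim_mulDr invlim_neq0.

End InvLimRing.

Section PadicSystem.
Variables (p : nat) (pr : prime p).

Lemma padic_mod_gt1 n : (1 < p ^ n.+1)%N.
Proof. by rewrite -(exp1n n.+1) ltn_exp2r // prime_gt1. Qed.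

Definition padic_trans n (x : 'Z_(p ^ n.+2)) : 'Z_(p ^ n.+1) := (x : nat)%:R.

Lemma padic_trans_val n (x : 'Z_(p ^ n.+2)) :
  (padic_trans x : nat) = (x %% p ^ n.+1)%N.
Proof. by rewrite /padic_trans val_Zp_nat // padic_mod_gt1. Qed.

Lemma Zmod_eqP n (x y : 'Z_(p ^ n.+1)) : (x : nat) = y -> x = y.
Proof. exact: val_inj. Qed.

Lemma Zmod_lt n (x : 'Z_(p ^ n.+1)) : (x < p ^ n.+1)%N.
Proof.
by apply: leq_trans (ltn_ord x) _; rewrite Zp_cast // padic_mod_gt1.
Qed.

Lemma Zmod_valD n (x y : 'Z_(p ^ n.+1)) :
  nat_of_ord (x + y) = ((x + y) %% p ^ n.+1)%N.
Proof. by congr (_ %% _)%N; rewrite Zp_cast // padic_mod_gt1. Qed.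

Lemma Zmod_valM n (x y : 'Z_(p ^ n.+1)) :
  nat_of_ord (x * y) = ((x * y) %% p ^ n.+1)%N.
Proof. by congr (_ %% _)%N; rewrite Zp_cast // padic_mod_gt1. Qed.

Fact padic_trans_additive n : zmod_morphism (@padic_trans n).
Proof.
have D : {morph @padic_trans n : x y / x + y}.
  move=> x y; apply: Zmod_eqP.
  rewrite padic_trans_val !Zmod_valD !padic_trans_val modnDm.
  by rewrite modn_dvdm // dvdn_exp2l.
move=> x y; apply: (addIr (padic_trans y)).
by rewrite -D !subrK.
Qed.

Fact padic_trans_multiplicative n : monoid_morphism (@padic_trans n).
Proof.
split.
  apply: Zmod_eqP; rewrite padic_trans_val.
  by rewrite /= modn_small ?padic_mod_gt1.
move=> x y; apply: Zmod_eqP.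
rewrite padic_trans_val !Zmod_valM !padic_trans_val modnMm.
by rewrite modn_dvdm // dvdn_exp2l.
Qed.

HB.instance Definition _ n := GRing.isZmodMorphism.Build
  'Z_(p ^ n.+2) 'Z_(p ^ n.+1) (@padic_trans n) (@padic_trans_additive n).
HB.instance Definition _ n := GRing.isMonoidMorphism.Build
  'Z_(p ^ n.+2) 'Z_(p ^ n.+1) (@padic_trans n) (@padic_trans_multiplicative n).

(* The component of index n of a p-adic integer is its class mod p ^ n.+1:
   the index is shifted because 'Z_1 is not the zero ring in MathComp. *)
Definition padic_system : inv_system :=
  @InvSystem (fun n => 'Z_(p ^ n.+1)) (fun n => @padic_trans n).

Definition Zp := invlim padic_system.

Definition approx (a : Zp) (n : nat) : nat := (a n : 'Z_(p ^ n.+1)).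

HB.instance Definition _ := GRing.NzRing.on Zp.

Fact Zp_mulC : @commutative Zp Zp *%R.
Proof. by move=> x y; apply: invlim_eqP => n; apply: mulrC. Qed.
HB.instance Definition _ := GRing.PzRing_hasCommutativeMul.Build Zp Zp_mulC.

Definition Zp_unit : {pred Zp} := fun x => `[< exists y : Zp, y * x = 1 >].
Definition Zp_inv (x : Zp) : Zp := xget x [set y | y * x = 1].

Fact Zp_mulVx : {in Zp_unit, left_inverse 1 Zp_inv *%R}.
Proof.
move=> x /asboolP [y yx]; rewrite /Zp_inv.
by case: xgetP => [z _ //|/(_ y)]; case.
Qed.
Fact Zp_unitP (x y : Zp) : y * x = 1 -> Zp_unit x.
Proof. by move=> yx; apply/asboolP; exists y. Qed.
Fact Zp_inv_out : {in [predC Zp_unit], Zp_inv =1 id}.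
Proof.
move=> x /= /negP nu; rewrite /Zp_inv; case: xgetP => // z _ zx.
by case: nu; apply: (Zp_unitP zx).
Qed.
HB.instance Definition _ := GRing.ComNzRing_hasMulInverse.Build Zp
  Zp_mulVx Zp_unitP Zp_inv_out.

Lemma approx_mod (x : Zp) n k : (approx x (n + k) %% p ^ n.+1)%N = approx x n.
Proof.
elim: k => [|k IHk].
  by rewrite addn0 modn_small // Zmod_lt.
have e : approx x (n + k) = (approx x (n + k.+1) %% p ^ (n + k).+1)%N.
  rewrite /approx addnS -padic_trans_val.
  by rewrite -[in LHS](componentP x (n + k)).
by rewrite -IHk e modn_dvdm // dvdn_exp2l // ltnS leq_addr.
Qed.

Lemma approx0 n : approx 0 n = 0%N. Proof. by []. Qed.

Lemma approx_inj (x y : Zp) : (forall n, approx x n = approx y n) -> x = y.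
Proof. by move=> e; apply: invlim_eqP => n; apply: Zmod_eqP; apply: e. Qed.

Lemma Zp_neq0P (x : Zp) : x != 0 ->
  exists a, forall k, ~~ (p ^ a.+1 %| approx x (a + k))%N.
Proof.
move=> /eqP xn0; have [//|] := pselect (exists a, approx x a <> 0%N); last first.
  move=> none; case: xn0; apply: approx_inj => n; rewrite approx0.
  by apply: contrapT => h; apply: none; exists n.
case=> a xa; exists a => k; apply/negP => /eqP h.
by apply: xa; rewrite -h approx_mod.
Qed.

Lemma approxM (x y : Zp) n :
  approx (x * y) n = ((approx x n * approx y n) %% p ^ n.+1)%N.
Proof. exact: Zmod_valM. Qed.

Lemma prime_Ndvd_mul a b u v : ~~ (p ^ a.+1 %| u)%N -> ~~ (p ^ b.+1 %| v)%N ->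
  ~~ (p ^ (a + b).+1 %| u * v)%N.
Proof.
move=> nu nv.
have u0 : (0 < u)%N by case: u nu => //; rewrite dvdn0.
have v0 : (0 < v)%N by case: v nv => //; rewrite dvdn0.
move: nu nv; rewrite !pfactor_dvdn ?muln_gt0 ?u0 //.
rewrite lognM // -!ltnNge !ltnS; exact: leq_add.
Qed.

Fact Zp_idomain (x y : Zp) : x * y = 0 -> (x == 0) || (y == 0).
Proof.
move=> xy0; apply/norP => -[/Zp_neq0P[a xa] /Zp_neq0P[b yb]].
have := prime_Ndvd_mul (xa b) (yb a); rewrite [X in approx y X]addnC.
by rewrite /dvdn -approxM xy0 approx0.
Qed.
HB.instance Definition _ := GRing.ComUnitRing_isIntegral.Build Zp Zp_idomain.

Definition Qp := {fraction Zp}.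
HB.instance Definition _ := GRing.Field.on Qp.

End PadicSystem.

Section Integers.
Variables (p : nat) (pr : prime p).

Definition Zp_to (E : fieldExtType (Qp pr)) : {rmorphism Zp pr -> E} :=
  (in_alg E : {rmorphism Qp pr -> E}) \o
  (@tofrac (Zp pr) : {rmorphism Zp pr -> Qp pr}).

Variable E : fieldExtType (Qp pr).

Definition is_integer : {pred E} := fun x => `[< integralOver (Zp_to E) x >].

Fact is_integer_subring : subring_closed is_integer.
Proof.
split=> [|x y /asboolP xi /asboolP yi|x y /asboolP xi /asboolP yi]; apply/asboolP.
- exact: integral1.
- exact: integral_sub.
- exact: integral_mul.
Qed.
HB.instance Definition _ :=
  GRing.isSubringClosed.Build E is_integer is_integer_subring.

Record integers := Integer {
  integer_val :> E;
  integerP : integer_val \in is_integer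
}.
HB.instance Definition _ := [isSub for integer_val].
HB.instance Definition _ := [Choice of integers by <:].
HB.instance Definition _ := [SubChoice_isSubComNzRing of integers by <:].

End Integers.

Section IntegersFunctor.
Variables (p : nat) (pr : prime p) (E L : fieldExtType (Qp pr)).
Variable iota : {lrmorphism E -> L}.

Lemma integers_map_subproof (x : integers E) :
  iota (integer_val x) \in @is_integer _ pr L.
Proof.
case: x => x /= /asboolP [q mq qx]; apply/asboolP; exists q => //.
have -> : map_poly (Zp_to L) q = map_poly iota (map_poly (Zp_to E) q).
  rewrite -map_poly_comp; apply: eq_map_poly => a /=.
  by rewrite linearZ /= rmorph1.
by rewrite rmorph_root.
Qed.

Definition integers_map (x : integers E) : integers L :=
  Integer (integers_map_subproof x).

End IntegersFunctor.

Record fps (R : Type) := Fps { coef :> nat -> R }.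

Lemma fps_eqP (R : Type) (F G : fps R) : (forall n, F n = G n) -> F = G.
Proof. by case: F G => [F] [G] /= e; congr Fps; apply: funext. Qed.

HB.instance Definition _ (R : Type) := gen_eqMixin (fps R).
HB.instance Definition _ (R : Type) := gen_choiceMixin (fps R).

Section FpsRing.
Variable R : comNzRingType.
Implicit Types F G H : fps R.

Definition fpsC (c : R) : fps R := Fps (fun n => if n == 0%N then c else 0).
Definition fpsX : fps R := Fps (fun n => (n == 1%N)%:R).
Definition fpsD F G : fps R := Fps (fun n => F n + G n).
Definition fpsN F : fps R := Fps (fun n => - F n).
Definition fpsM F G : fps R :=
  Fps (fun n => \sum_(i < n.+1) F i * G (n - i)%N).

Fact fps_addA : associative fpsD.
Proof. by move=> F G H; apply: fps_eqP => n; apply: addrA. Qed.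
Fact fps_addC : commutative fpsD.
Proof. by move=> F G; apply: fps_eqP => n; apply: addrC. Qed.
Fact fps_add0 : left_id (fpsC 0) fpsD.
Proof. by move=> F; apply: fps_eqP => n /=; rewrite if_same add0r. Qed.
Fact fps_addN : left_inverse (fpsC 0) fpsN fpsD.
Proof. by move=> F; apply: fps_eqP => n /=; rewrite if_same addNr. Qed.
HB.instance Definition _ := GRing.isZmodule.Build (fps R)
  fps_addA fps_addC fps_add0 fps_addN.

Definition fps_trunc (N : nat) F : {poly R} := \poly_(i < N) F i.

Lemma fps_truncM N F G n : (n < N)%N ->
  fpsM F G n = (fps_trunc N F * fps_trunc N G)`_n.
Proof.
move=> nN; rewrite coefM /=; apply: eq_bigr => i _.
by rewrite !coef_poly (leq_ltn_trans _ nN) ?leq_ord // (leq_ltn_trans _ nN) ?leq_subr.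
Qed.

Lemma coefM_low (P Q P' Q' : {poly R}) n :
  (forall i, (i <= n)%N -> P`_i = P'`_i) ->
  (forall i, (i <= n)%N -> Q`_i = Q'`_i) -> (P * Q)`_n = (P' * Q')`_n.
Proof.
move=> eP eQ; rewrite !coefM; apply: eq_bigr => i _.
by rewrite eP ?leq_ord // eQ ?leq_subr.
Qed.

Lemma coef_trunc N F n : (n < N)%N -> (fps_trunc N F)`_n = F n.
Proof. by move=> nN; rewrite coef_poly nN. Qed.

Fact fps_mulA : associative fpsM.
Proof.
move=> F G H; apply: fps_eqP => n; rewrite !(@fps_truncM n.+1) //.
transitivity ((fps_trunc n.+1 F * (fps_trunc n.+1 G * fps_trunc n.+1 H))`_n).
  apply: coefM_low => // i ilen.
  by rewrite coef_trunc // (@fps_truncM n.+1).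
rewrite mulrA; apply: coefM_low => // i ilen.
by rewrite coef_trunc // (@fps_truncM n.+1).
Qed.
Fact fps_mulC : commutative fpsM.
Proof.
by move=> F G; apply: fps_eqP => n; rewrite !(@fps_truncM n.+1) // mulrC.
Qed.
Fact fps_mul1 : left_id (fpsC 1) fpsM.
Proof.
move=> F; apply: fps_eqP => n /=; rewrite big_ord_recl /= mul1r subn0.
by rewrite big1 ?addr0 // => i _; rewrite mul0r.
Qed.
Fact fps_mulDl : left_distributive fpsM fpsD.
Proof.
move=> F G H; apply: fps_eqP => n /=; rewrite -big_split /=.
by apply: eq_bigr => i _; rewrite mulrDl.
Qed.
Fact fps_neq0 : fpsC 1 != fpsC 0.
Proof.
apply/eqP => /(congr1 (fun F : fps R => F 0%N)) /eqP.
by rewrite /= oner_eq0.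
Qed.
HB.instance Definition _ := GRing.Zmodule_isComNzRing.Build (fps R)
  fps_mulA fps_mulC fps_mul1 fps_mulDl fps_neq0.

End FpsRing.

Definition fps_map (R S : Type) (f : R -> S) (F : fps R) : fps S :=
  Fps (fun n => f (F n)).

(* Topology: the p-adic topology on R, and the topology of coefficientwise
   p-adic convergence on R[[pi]]; the latter is the (p, pi)-adic topology. *)

Section FpsTopology.
Variables (p : nat) (R : comNzRingType).

Definition padic_cvg (u : nat -> R) (l : R) : Prop :=
  forall N, exists K, forall k, (K <= k)%N ->
    exists y, u k - l = p%:R ^+ N * y.

Definition fps_cvg (U : nat -> fps R) (F : fps R) : Prop :=
  forall m, padic_cvg (fun k => U k m) (F m).

(* 0 when the sequence diverges *)
Definition fps_lim (U : nat -> fps R) : fps R := xget 0 [set F | fps_cvg U F].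

(* F(G) = \sum_k F_k G^k *)
Definition fps_subst (F G : fps R) : fps R :=
  fps_lim (fun K => \sum_(k < K) fpsC (F k) * G ^+ k).

End FpsTopology.

Record group_ring (R : Type) (G : finType) := GroupRing {
  gcoef :> {ffun G -> R}
}.

Lemma group_ring_eqP (R : Type) (G : finType) (x y : group_ring R G) :
  (forall g, x g = y g) -> x = y.
Proof. by case: x y => [x] [y] /= e; congr GroupRing; apply/ffunP. Qed.

HB.instance Definition _ (R : Type) (G : finType) := gen_eqMixin (group_ring R G).
HB.instance Definition _ (R : Type) (G : finType) := gen_choiceMixin (group_ring R G).

Section GroupRingTheory.
Variables (R : comNzRingType) (G : finGroupType).
Local Notation RG := (group_ring R G).
Implicit Types x y z : RG.

Definition gr0 : RG := GroupRing [ffun=> 0].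
Definition gr1 : RG := GroupRing [ffun g => (g == 1%g)%:R].
Definition grN x : RG := GroupRing [ffun g => - x g].
Definition grD x y : RG := GroupRing [ffun g => x g + y g].
Definition grM x y : RG := GroupRing [ffun g => \sum_h x h * y (h^-1 * g)%g].

Fact gr_addA : associative grD.
Proof. by move=> x y z; apply: group_ring_eqP => g; rewrite !ffunE addrA. Qed.
Fact gr_addC : commutative grD.
Proof. by move=> x y; apply: group_ring_eqP => g; rewrite !ffunE addrC. Qed.
Fact gr_add0 : left_id gr0 grD.
Proof. by move=> x; apply: group_ring_eqP => g; rewrite !ffunE add0r. Qed.
Fact gr_addN : left_inverse gr0 grN grD.
Proof. by move=> x; apply: group_ring_eqP => g; rewrite !ffunE addNr. Qed.
HB.instance Definition _ := GRing.isZmodule.Build RG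
  gr_addA gr_addC gr_add0 gr_addN.

Fact gr_mulA : associative grM.
Proof.
move=> x y z; apply: group_ring_eqP => g; rewrite !ffunE.
under eq_bigr do rewrite ffunE mulr_sumr.
under [RHS]eq_bigr do rewrite ffunE mulr_suml.
rewrite [RHS]exchange_big /=; apply: eq_bigr => h _.
rewrite (reindex_inj (mulgI h^-1%g)) /=; apply: eq_bigr => k _.
by rewrite mulrA invMg invgK mulgA -[(k^-1 * h * h^-1)%g]mulgA mulgV mulg1.
Qed.
Fact gr_mul1l : left_id gr1 grM.
Proof.
move=> x; apply: group_ring_eqP => g; rewrite ffunE (bigD1 1%g) //=.
rewrite ffunE eqxx mul1r invg1 mul1g big1 ?addr0 // => h /negbTE h1.
by rewrite ffunE h1 mul0r.
Qed.
Fact gr_mul1r : right_id gr1 grM.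
Proof.
move=> x; apply: group_ring_eqP => g; rewrite ffunE (bigD1 g) //=.
rewrite ffunE mulVg eqxx mulr1 big1 ?addr0 // => h hg.
rewrite ffunE -eq_mulVg1 (negbTE hg) mulr0 //.
Qed.
Fact gr_mulDl : left_distributive grM grD.
Proof.
move=> x y z; apply: group_ring_eqP => g; rewrite !ffunE -big_split /=.
by apply: eq_bigr => h _; rewrite !ffunE mulrDl.
Qed.
Fact gr_mulDr : right_distributive grM grD.
Proof.
move=> x y z; apply: group_ring_eqP => g; rewrite !ffunE -big_split /=.
by apply: eq_bigr => h _; rewrite !ffunE mulrDr.
Qed.
Fact gr_neq0 : gr1 != gr0.
Proof.
apply/eqP => /(congr1 (fun x : RG => x 1%g)) /eqP.
by rewrite !ffunE eqxx oner_eq0.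
Qed.
HB.instance Definition _ := GRing.Zmodule_isNzRing.Build RG
  gr_mulA gr_mul1l gr_mul1r gr_mulDl gr_mulDr gr_neq0.

End GroupRingTheory.

Section GroupRingMap.
Variables (R : comNzRingType) (G H : finGroupType) (f : G -> H).
Hypothesis fM : {morph f : x y / (x * y)%g}.

Definition gr_map (x : group_ring R G) : group_ring R H :=
  GroupRing [ffun h => \sum_(g | f g == h) x g].

Fact gr_map_additive : zmod_morphism gr_map.
Proof.
move=> x y; apply: group_ring_eqP => h; rewrite !ffunE -sumrN -big_split /=.
by apply: eq_bigr => g _; rewrite !ffunE.
Qed.

Fact gr_map_multiplicative : monoid_morphism gr_map.
Proof.
have f1 : f 1%g = 1%g by apply: (mulgI (f 1%g)); rewrite -fM !mulg1.
split.
  apply: group_ring_eqP => h; rewrite !ffunE; have [->|hn1] := eqVneq h 1%g.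
    rewrite (bigD1 1%g) /=; last by rewrite f1.
    rewrite ffunE eqxx big1 ?addr0 // => g /andP[_ /negbTE g1].
    by rewrite ffunE g1.
  rewrite big1 // => g fg; rewrite ffunE; have [g1|//] := eqVneq g 1%g.
  by move: fg; rewrite g1 f1 eq_sym (negbTE hn1).
move=> x y; apply: group_ring_eqP => h; rewrite !ffunE.
under eq_bigr do rewrite ffunE.
rewrite exchange_big /=.
under [RHS]eq_bigr do rewrite !ffunE mulr_suml.
rewrite [RHS](exchange_big_dep predT) //=; apply: eq_bigr => a _.
rewrite (big_pred1 (f a)); last by move=> b /=; rewrite eq_sym.
rewrite mulr_sumr (reindex_inj (mulgI a)) /=.
apply: eq_big => [b|b _]; last by rewrite mulKg.
rewrite fM; apply/eqP/eqP => [<-|->]; first by rewrite mulKg.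
by rewrite mulKVg.
Qed.

End GroupRingMap.

(* Q(X): the smallest subfield of algC containing X. *)
Definition Qgen (X : set algC) : {pred algC} := fun x =>
  `[< forall S : {pred algC}, divring_closed S ->
        (forall y, X y -> y \in S) -> x \in S >].

Fact Qgen_divring (X : set algC) : divring_closed (Qgen X).
Proof.
split=> [|x y /asboolP hx /asboolP hy|x y /asboolP hx /asboolP hy];
  apply/asboolP => S cS XS; case: (cS) => S1 SB SV.
- exact: S1.
- by apply: SB; [exact: hx | exact: hy].
- by apply: SV; [exact: hx | exact: hy].
Qed.

Definition mu (m : nat) : set algC := [set z | z ^+ m = 1].
Definition mu_pinf (p : nat) : set algC := [set z | exists n, mu (p ^ n) z].

Definition in_Qmu (p : nat) : {pred algC} := Qgen (mu_pinf p).

Fact in_Qmu_divring p : divring_closed (in_Qmu p).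
Proof. exact: Qgen_divring. Qed.
HB.instance Definition _ p :=
  GRing.isDivringClosed.Build algC (in_Qmu p) (in_Qmu_divring p).

Record Qmu (p : nat) := QmuElt {
  Qmu_val :> algC;
  QmuP : Qmu_val \in in_Qmu p
}.
HB.instance Definition _ p := [isSub for @Qmu_val p].
HB.instance Definition _ p := [Choice of Qmu p by <:].
HB.instance Definition _ p := [SubChoice_isSubIntegralDomain of Qmu p by <:].
HB.instance Definition _ p := [SubIntegralDomain_isSubField of Qmu p by <:].

(* Gal(Q(mu_{p^oo}) / Q): Q is the prime field, so every ring automorphism of
   Q(mu_{p^oo}) fixes it. *)
Record Gamma (p : nat) := GammaElt {
  gal :> {rmorphism Qmu p -> Qmu p};
  gal_bij : bijective gal
}.

HB.instance Definition _ p := gen_eqMixin (Gamma p).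
HB.instance Definition _ p := gen_choiceMixin (Gamma p).

Section GammaGroup.
Variable p : nat.
Implicit Types s t u : Gamma p.

Lemma Gamma_eqP s t : (forall x, s x = t x) -> s = t.
Proof.
case: s t => [s sB] [t tB] /= e.
have {}e : s = t.
  case: s t e {sB tB} => [f [[fA] [fM]]] [g [[gA] [gM]]] /= e.
  have {}e : f = g by apply: funext.
  case: g / e gA gM => gA gM.
  by rewrite (Prop_irrelevance fA gA) (Prop_irrelevance fM gM).
by case: t / e tB => tB; congr GammaElt; exact: Prop_irrelevance.
Qed.

Definition Gamma1 : Gamma p :=
  @GammaElt p (idfun : {rmorphism Qmu p -> Qmu p}) (Bijective (frefl id) (frefl id)).

Definition GammaM s t : Gamma p :=
  @GammaElt p ((gal s : {rmorphism _ -> _}) \o (gal t : {rmorphism _ -> _}))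
    (bij_comp (gal_bij s) (gal_bij t)).

Definition Gamma_inv_fun s (x : Qmu p) : Qmu p := xget 0 [set y | s y = x].

Lemma Gamma_inv_funK s : cancel (Gamma_inv_fun s) s.
Proof.
move=> x; rewrite /Gamma_inv_fun; case: xgetP => [y _ //|none].
by have [g _ gK] := gal_bij s; case: (none (g x)); apply: gK.
Qed.

Lemma Gamma_fun_invK s : cancel s (Gamma_inv_fun s).
Proof. by move=> x; apply: (fmorph_inj s); rewrite Gamma_inv_funK. Qed.

Fact Gamma_inv_additive s : zmod_morphism (Gamma_inv_fun s).
Proof. by move=> x y; apply: (fmorph_inj s); rewrite rmorphB !Gamma_inv_funK. Qed.

Fact Gamma_inv_multiplicative s : monoid_morphism (Gamma_inv_fun s).
Proof.
split; first by apply: (fmorph_inj s); rewrite rmorph1 Gamma_inv_funK.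
by move=> x y; apply: (fmorph_inj s); rewrite rmorphM !Gamma_inv_funK.
Qed.

HB.instance Definition _ s := GRing.isZmodMorphism.Build (Qmu p) (Qmu p)
  (Gamma_inv_fun s) (@Gamma_inv_additive s).
HB.instance Definition _ s := GRing.isMonoidMorphism.Build (Qmu p) (Qmu p)
  (Gamma_inv_fun s) (@Gamma_inv_multiplicative s).

Definition GammaV s : Gamma p :=
  @GammaElt p (Gamma_inv_fun s : {rmorphism _ -> _})
    (Bijective (@Gamma_inv_funK s) (@Gamma_fun_invK s)).

Fact GammaMA : associative GammaM.
Proof. by move=> s t u; apply: Gamma_eqP. Qed.
Fact GammaM1 : left_id Gamma1 GammaM.
Proof. by move=> s; apply: Gamma_eqP. Qed.
Fact GammaM1r : right_id Gamma1 GammaM.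
Proof. by move=> s; apply: Gamma_eqP. Qed.
Fact GammaMV : left_inverse Gamma1 GammaV GammaM.
Proof. by move=> s; apply: Gamma_eqP => x /=; apply: Gamma_fun_invK. Qed.
Fact GammaMVr : right_inverse Gamma1 GammaV GammaM.
Proof. by move=> s; apply: Gamma_eqP => x /=; apply: Gamma_inv_funK. Qed.
HB.instance Definition _ := isGroup.Build (Gamma p)
  GammaMA GammaM1 GammaM1r GammaMV GammaMVr.

(* Gal(Q(mu_{p^oo}) / Q(mu_{p^n})) *)
Definition Gamma_sub (n : nat) : set (Gamma p) :=
  [set s | forall x : Qmu p, val x \in Qgen (mu (p ^ n)) -> s x = x].

End GammaGroup.

Section GammaCongruence.
Variables (p : nat) (n : nat).
Implicit Types s t u : Gamma p.

Lemma Qmu_valX (x : Qmu p) k : Qmu_val (x ^+ k) = Qmu_val x ^+ k.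
Proof. exact: (rmorphXn (val : {rmorphism Qmu p -> algC})). Qed.

Lemma Qmu_root (x : Qmu p) k : x ^+ k = 1 <-> Qmu_val x ^+ k = 1.
Proof.
rewrite -Qmu_valX; have v1 : Qmu_val 1 = 1 := rmorph1 (val : {rmorphism Qmu p -> algC}).
split=> [->//|xk]; by apply: val_inj; rewrite /= xk.
Qed.

Lemma Gamma_subP s :
  Gamma_sub n s <-> (forall x : Qmu p, x ^+ (p ^ n) = 1 -> s x = x).
Proof.
split=> [h x xn|h x /asboolP hx].
  by apply: h; apply/asboolP => S _; apply; apply/Qmu_root.
pose S : {pred algC} := fun a => `[< exists2 y : Qmu p, val y = a & s y = y >].
suff : val x \in S by case/asboolP => y /val_inj ->.
apply: hx => [|z zn].
  split=> [|a b /asboolP[y <- sy] /asboolP[z <- sz]|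
           a b /asboolP[y <- sy] /asboolP[z <- sz]]; apply/asboolP.
  - by exists 1; rewrite ?rmorph1.
  - by exists (y - z); rewrite ?rmorphB //= sy sz.
  - by exists (y / z); rewrite ?fmorph_div //= sy sz.
have zK : z \in in_Qmu p.
  by apply/asboolP => T _; apply; exists n.
by apply/asboolP; exists (QmuElt zK) => //; apply: h; apply/Qmu_root.
Qed.

Definition Gamma_rel s t : bool := `[< Gamma_sub n (s^-1 * t)%g >].

Lemma Gamma_relP s t :
  reflect (forall x : Qmu p, x ^+ (p ^ n) = 1 -> s x = t x) (Gamma_rel s t).
Proof.
apply: (iffP (asboolP _)) => [/Gamma_subP h x xn|h].
  by rewrite -[in LHS](h x xn); apply: Gamma_inv_funK.
apply/Gamma_subP => x xn; rewrite -[RHS](Gamma_fun_invK s) h //.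
Qed.

Fact Gamma_rel_refl : reflexive Gamma_rel.
Proof. by move=> s; apply/Gamma_relP. Qed.
Fact Gamma_rel_sym : symmetric Gamma_rel.
Proof. by move=> s t; apply/Gamma_relP/Gamma_relP => h x /h. Qed.
Fact Gamma_rel_trans : transitive Gamma_rel.
Proof.
move=> t s u /Gamma_relP st /Gamma_relP tu; apply/Gamma_relP => x xn.
by rewrite st // tu.
Qed.
Canonical Gamma_equiv :=
  EquivRel Gamma_rel Gamma_rel_refl Gamma_rel_sym Gamma_rel_trans.

End GammaCongruence.

(* The proof that p is prime is a parameter of the type so that the finite
   group structure, which needs p != 0, can be inferred. *)
Definition Gamma_quot (p : nat) (_ : prime p) (n : nat) :=
  {eq_quot (Gamma_equiv p n)}%qT.

Section GammaQuotient.
Variables (p : nat) (pr : prime p) (n : nat).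
Local Notation Gamma_quot := (@Gamma_quot p pr n).
Implicit Types s t u : Gamma p.

HB.instance Definition _ := Choice.on Gamma_quot.
HB.instance Definition _ := Quotient.on Gamma_quot.
Implicit Types a b c : Gamma_quot.

Definition to_quot (s : Gamma p) : Gamma_quot := (\pi_Gamma_quot s)%qT.

Lemma to_quotP s t : to_quot s = to_quot t <-> 
  (forall x : Qmu p, x ^+ (p ^ n) = 1 -> s x = t x).
Proof.
split; first by move/eqmodP => /Gamma_relP.
by move=> h; apply/eqmodP/Gamma_relP.
Qed.

Definition gq_lift (a : Gamma_quot) : Gamma p := generic_quotient.repr a.

Lemma gq_liftK a : to_quot (gq_lift a) = a.
Proof. exact: reprK. Qed.

Lemma repr_quotP s (x : Qmu p) : x ^+ (p ^ n) = 1 -> gq_lift (to_quot s) x = s x.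
Proof. by move: x; apply/to_quotP; rewrite gq_liftK. Qed.

Definition quot1 : Gamma_quot := to_quot 1%g.
Definition quotM a b : Gamma_quot := to_quot (gq_lift a * gq_lift b)%g.
Definition quotV a : Gamma_quot := to_quot (gq_lift a)^-1%g.

Lemma gal_root s (x : Qmu p) : x ^+ (p ^ n) = 1 -> s x ^+ (p ^ n) = 1.
Proof. by move=> xn; rewrite -rmorphXn xn rmorph1. Qed.

Lemma to_quotM s t : to_quot (s * t)%g = quotM (to_quot s) (to_quot t).
Proof.
apply/to_quotP => x xn; change (s (t x) = gq_lift (to_quot s) (gq_lift (to_quot t) x)).
by rewrite repr_quotP // repr_quotP // gal_root.
Qed.

Lemma quot_ind (P : Gamma_quot -> Prop) : (forall s, P (to_quot s)) -> forall a, P a.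
Proof. by move=> h a; rewrite -[a]gq_liftK; apply: h. Qed.

Fact quotMA : associative quotM.
Proof.
elim/quot_ind => s; elim/quot_ind => t; elim/quot_ind => u.
by rewrite -!to_quotM mulgA.
Qed.
Fact quotM1 : left_id quot1 quotM.
Proof. by elim/quot_ind => s; rewrite -to_quotM mul1g. Qed.
Fact quotMV : left_inverse quot1 quotV quotM.
Proof.
by move=> a; rewrite -[X in quotM _ X]gq_liftK -to_quotM mulVg.
Qed.

Lemma Gamma_quot_code :
  {code : Gamma_quot -> 'I_(p ^ n) & {dec : _ -> option Gamma_quot | pcancel code dec}}.
Proof.
have pn0 : (0 < p ^ n)%N by rewrite expn_gt0 prime_gt0.
have [z zP] := C_prim_root_exists pn0.
have zn := prim_expr_order zP.
have zK : z \in in_Qmu p by apply/asboolP => S _; apply; exists n.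
pose w := QmuElt zK.
have wP (x : Qmu p) : x ^+ (p ^ n) = 1 -> {k : 'I_(p ^ n) | x = w ^+ k}.
  move=> /Qmu_root /(prim_rootP zP)[k xk]; exists k.
  by apply: val_inj; rewrite /= xk Qmu_valX.
have wn : w ^+ (p ^ n) = 1 by apply/Qmu_root.
pose code (a : Gamma_quot) := sval (wP _ (gal_root (gq_lift a) wn)).
have codeE a : gq_lift a w = w ^+ code a by rewrite /code; case: (wP _ _).
have code_inj : injective code.
  move=> a b ab; rewrite -[a]gq_liftK -[b]gq_liftK.
  apply/to_quotP => x /wP[k ->].
  by rewrite !rmorphXn; congr (_ ^+ k); rewrite !codeE ab.
exists code.
exists (fun k => if pselect (exists a, code a = k) is left e
                 then Some (sval (cid e)) else None).
move=> a; case: pselect => [e|[]]; last by exists a.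
by congr Some; apply: code_inj; rewrite (svalP (cid e)).
Qed.

Definition gq_code : Gamma_quot -> 'I_(p ^ n) := projT1 Gamma_quot_code.
Definition gq_decode : 'I_(p ^ n) -> option Gamma_quot :=
  sval (projT2 Gamma_quot_code).
Fact gq_codeK : pcancel gq_code gq_decode.
Proof. exact: svalP (projT2 Gamma_quot_code). Qed.
HB.instance Definition _ : isCountable Gamma_quot := PCanIsCountable gq_codeK.
HB.instance Definition _ : isFinite Gamma_quot := PCanIsFinite gq_codeK.
HB.instance Definition _ := Finite_isGroup.Build Gamma_quot
  quotMA quotM1 quotMV.

Lemma to_quot_morph : {morph to_quot : s t / (s * t)%g}.
Proof. exact: to_quotM. Qed.

End GammaQuotient.

Section Iwasawa.
Variables (p : nat) (pr : prime p).

Definition gq_trans n (a : Gamma_quot pr n.+1) : Gamma_quot pr n :=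
  to_quot pr n (gq_lift a).

Lemma gq_transM n : {morph @gq_trans n : a b / (a * b)%g}.
Proof.
have E s : gq_trans (to_quot pr n.+1 s) = to_quot pr n s.
  apply/to_quotP => x xn; apply: repr_quotP.
  by rewrite expnS mulnC exprM xn expr1n.
elim/quot_ind => s; elim/quot_ind => t.
by rewrite -to_quot_morph !E to_quot_morph.
Qed.

Variable E : fieldExtType (Qp pr).
Local Notation O := (integers E).

Definition Lambda_level (n : nat) : nzRingType := group_ring O (Gamma_quot pr n).

Definition Lambda_trans n : Lambda_level n.+1 -> Lambda_level n :=
  gr_map (@gq_trans n).

HB.instance Definition _ n := GRing.isZmodMorphism.Build
  (Lambda_level n.+1) (Lambda_level n) (@Lambda_trans n)
  (@gr_map_additive O _ _ (@gq_trans n)).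
HB.instance Definition _ n := GRing.isMonoidMorphism.Build
  (Lambda_level n.+1) (Lambda_level n) (@Lambda_trans n)
  (@gr_map_multiplicative O _ _ (@gq_trans n) (@gq_transM n)).

Definition Lambda_system : inv_system := InvSystem Lambda_trans.

(* O[[Gamma]], the inverse limit of the O[Gamma / Gamma_n] *)
Definition Lambda := invlim Lambda_system.
HB.instance Definition _ := GRing.NzRing.on Lambda.

Definition to_level n (l : Lambda) : Lambda_level n := l n.

(* A^+_{Q_p} = O[[pi]] *)
Local Notation A := (fps O).
Local Notation "'pi" := (fpsX O).

Definition phi (F : A) : A := fps_subst p F ((1 + 'pi) ^+ p - 1).

(* (1 + pi)^a for a in Z_p, the limit of its natural powers (1 + pi)^(a_m)
   with a_m congruent to a mod p^(m+1) *)
Definition one_plus_pi_pow (a : Zp pr) : A :=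
  fps_lim p (fun m => (1 + 'pi) ^+ approx a m).

(* The cyclotomic character, with values in the units of Z_p: the unique a
   such that s(x) = x^a for all p-power roots of unity x. *)
Definition chi (s : Gamma p) : Zp pr :=
  xget 1 [set a | forall (k : nat) (x : Qmu p),
                    x ^+ (p ^ k.+1) = 1 -> s x = x ^+ approx a k].

Definition Gamma_act (s : Gamma p) (F : A) : A :=
  fps_subst p F (one_plus_pi_pow (chi s) - 1).

(* The action of O[[Gamma]] extending that of Gamma by O-linearity and
   continuity: an element of O[[Gamma]] is the limit of any lifts to O[Gamma]
   of its images in the O[Gamma / Gamma_n]. *)
Definition Lambda_act (l : Lambda) (F : A) : A :=
  fps_lim p (fun n => \sum_(g : Gamma_quot pr n)
                        fpsC (to_level n l g) * Gamma_act (gq_lift g) F).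

Definition Mellin (l : Lambda) : A := Lambda_act l (1 + 'pi).

(* G = psi(F), that is p * phi(G) = \sum_(z^p = 1) F(z * (1 + pi) - 1).  The
   sum is computed over the ring of integers of any finite extension L of E
   over which X^p - 1 splits, zs being the list of its roots. *)
Definition is_psi (F G : A) : Prop :=
  exists (L : fieldExtType (Qp pr)) (iota : {lrmorphism E -> L})
         (zs : seq (integers L)),
    \prod_(z <- zs) ('X - z%:P) = 'X^p - 1 /\
    p%:R * fps_map (integers_map iota) (phi G) =
      \sum_(z <- zs) fps_subst p (fps_map (integers_map iota) F)
                                 (fpsC z * (1 + fpsX (integers L)) - 1).

(* G is unique because phi is injective; it exists for every F. *)
Definition psi (F : A) : A := xget 0 [set G | is_psi F G].

Definition ker_psi : set A := [set F | psi F = 0].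

Definition phin_ker_psi (n : nat) : set A :=
  [set iter n phi 'pi * F | F in ker_psi].

End Iwasawa.

Arguments Lambda_act {p pr} E.
Arguments ker_psi {p pr} E.
Arguments phin_ker_psi {p pr} E.

(* The quotient M / N of subgroups N <= M of V, as a set of cosets.  When M and
   N are stable under an action of R on V by additive maps, coset_add and
   coset_scale are the module operations of M / N:
   (x + N) + (y + N) = (x + y) + N and r (x + N) = (r x) + N. *)
Section Cosets.
Variables (R : Type) (V : zmodType) (act : R -> V -> V) (M N : set V).

Definition coset_of_sub (x : V) : set V := [set x + h | h in N].
Definition cosets : set (set V) := [set coset_of_sub x | x in M].
Definition coset_add (C D : set V) : set V := [set c + d | c in C & d in D].
Definition coset_scale (r : R) (C : set V) : set V :=
  [set act r c + h | c in C & h in N].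

End Cosets.

(* Main.v *)
Require Import Defs.
From HB Require Import structures.
From mathcomp Require Import all_boot all_order all_fingroup all_algebra all_field.
From mathcomp Require Import boolp classical_sets functions.
From mathcomp Require Import ring zify.

(* With u = 1 + pi, a series F in O[[pi]] is the same thing as an O-valued measure
   on Z_p, the power u^i being the Dirac measure at i: the masses of F on the
   classes j + p^n Z_p are continuous O-linear in F, and the powers of u span a
   dense submodule, so that every identity between masses is checked on powers
   of u.  Since F is congruent to the sum over j < p^n of mass(j + p^n Z_p) u^j
   modulo (p, pi)^(n + 1), a series is determined by its masses, and every
   compatible system of masses occurs.  Restricting a measure to the classes
   j + p^n Z_p gives F = sum_(j < p^n) u^j phi^n(G_j).  For n = 1 this yields
   psi(F) = G_0, so A^(psi = 0) consists of the measures carried by the units of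
   Z_p; for general n, the masses of F mod p^n are the constant terms of the G_j,
   hence phi^n(pi) A^(psi = 0) consists of the measures carried by the units with
   zero mass on every class mod p^n.  Thus the quotient is the module of functions
   on (Z/p^n)^*, that is on Gamma / Gamma_n, and Gamma acts by translation.

   The limits involved exist because the integral closure O of Z_p in E is
   p-adically complete and separated, which is proved by compactness of Z_p^d
   rather than by means of a discriminant. *)

Set Implicit Arguments.
Unset Strict Implicit.
Unset Printing Implicit Defensive.

Import GRing.Theory.
Local Open Scope ring_scope.

(** * Power series over p-adically complete rings *)

(** The isomorphism is built on [Lambda_level E n] itself, without choosing lifts to [Lambda]: an
    element x goes to the set of all series in A^(psi = 0) whose masses at the points of Gamma /
    Gamma_n are the coefficients of x. Such a set is a full coset, so bijectivity and additivity are
    read off the masses, linearity is the convolution formula of the group ring, and the link with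
    the Mellin transform is linearity at x = 1, because 1 + pi is the Dirac measure at 1. Limits,
    [psi] and [chi] are choices with a default value, hence each must be shown to exist and to be
    unique before it can be computed. For [psi] this forces work over the integers of an extension L
    containing the p-th roots of unity; the theory of power series is therefore developed over an
    abstract p-adically complete ring and applied to the integers of both E and L. *)

Definition dvp (p : nat) (R : comNzRingType) (N : nat) (x : R) : Prop :=
  exists y, x = p%:R ^+ N * y.

(** A condition on consecutive differences suffices for completeness: a sum of multiples of p^N is
    again a multiple of p^N. Absence of p-torsion serves to cancel the factor p in the equation
    defining psi. *)
Record padic_ring (p : nat) (R : comNzRingType) : Prop := PadicRing {
  padic_tf : forall x : R, p%:R * x = 0 -> x = 0;
  padic_sep : forall x : R, (forall N, dvp p N x) -> x = 0;
  padic_cpl : forall u : nat -> R,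
    (forall N, exists K, forall k, (K <= k)%N -> dvp p N (u k.+1 - u k)) ->
    exists l, padic_cvg p u l
}.

Section Divisibility.
Variables (p : nat) (R : comNzRingType).
Implicit Types (x y : R) (u v : nat -> R).
Local Notation dvp := (@dvp p R).

Lemma dvp_zero N : dvp N 0.
Proof. by exists 0; rewrite mulr0. Qed.

Lemma dvp0n x : dvp 0 x.
Proof. by exists x; rewrite expr0 mul1r. Qed.

Lemma dvpD N x y : dvp N x -> dvp N y -> dvp N (x + y).
Proof. by case=> a -> [b ->]; exists (a + b); rewrite mulrDr. Qed.

Lemma dvpN N x : dvp N x -> dvp N (- x).
Proof. by case=> a ->; exists (- a); rewrite mulrN. Qed.

Lemma dvpB N x y : dvp N x -> dvp N y -> dvp N (x - y).
Proof. by move=> hx /dvpN; apply: dvpD. Qed.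

Lemma dvpM M N x y : dvp M x -> dvp N y -> dvp (M + N) (x * y).
Proof. by case=> a -> [b ->]; exists (a * b); rewrite exprD; ring. Qed.

Lemma dvp_mull N x y : dvp N y -> dvp N (x * y).
Proof. by move=> h; rewrite -[N]add0n; apply: dvpM => //; apply: dvp0n. Qed.

Lemma dvp_le M N x : (M <= N)%N -> dvp N x -> dvp M x.
Proof.
by move=> /subnKC <- [y ->]; exists (p%:R ^+ (N - M) * y); rewrite exprD mulrA.
Qed.

Lemma dvp_sum N (I : Type) (r : seq I) (P : pred I) (f : I -> R) :
  (forall i, P i -> dvp N (f i)) -> dvp N (\sum_(i <- r | P i) f i).
Proof. by move=> h; apply: big_ind => //; [exact: dvp_zero|exact: dvpD]. Qed.

Lemma dvp_p : dvp 1 p%:R.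
Proof. by exists 1; rewrite mulr1. Qed.

Lemma padic_cvgB u v a b :
  padic_cvg p u a -> padic_cvg p v b -> padic_cvg p (fun k => u k - v k) (a - b).
Proof.
move=> hu hv N; have [K hK] := hu N; have [L hL] := hv N.
exists (maxn K L) => k; rewrite geq_max => /andP[kK kL].
have := dvpB (hK k kK) (hL k kL); congr dvp; ring.
Qed.

Lemma padic_cvg_dvp N u a K : padic_cvg p u a ->
  (forall k, (K <= k)%N -> dvp N (u k)) -> dvp N a.
Proof.
move=> hu hK; have [L hL] := hu N; pose k := maxn K L.
have -> : a = u k - (u k - a) by ring.
by apply: dvpB; [apply: hK; rewrite leq_maxl | apply: hL; rewrite leq_maxr].
Qed.

Hypothesis hR : padic_ring p R.

Lemma padic_cvg_uniq u a b : padic_cvg p u a -> padic_cvg p u b -> a = b.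
Proof.
move=> ha hb; apply/eqP; rewrite -subr_eq0; apply/eqP.
apply: (padic_sep hR) => N; apply: (padic_cvg_dvp (padic_cvgB ha hb) (K := 0%N)).
by move=> k _; rewrite subrr; apply: dvp_zero.
Qed.

End Divisibility.

Lemma padic_cvg_eventually (p : nat) (R : comNzRingType) (u : nat -> R) a K :
  (forall k, (K <= k)%N -> u k = a) -> padic_cvg p u a.
Proof.
by move=> h N; exists K => k /h ->; rewrite subrr; exists 0; rewrite mulr0.
Qed.

(** * The (p, pi)-adic filtration on R[[pi]] *)

Section Filtration.
Variables (p : nat) (R : comNzRingType).
Implicit Types (F G : fps R) (U V : nat -> fps R).
Local Notation dvp := (@dvp p R).

Lemma fps_coefD F G m : (F + G) m = F m + G m. Proof. by []. Qed.
Lemma fps_coefB F G m : (F - G) m = F m - G m. Proof. by []. Qed.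
Lemma fps_coefM F G m : (F * G) m = \sum_(i < m.+1) F i * G (m - i)%N. Proof. by []. Qed.
Lemma fps_coef0 m : (0 : fps R) m = 0. Proof. by rewrite /= if_same. Qed.

Lemma fps_coef_sum (I : Type) (r : seq I) (P : pred I) (f : I -> fps R) m :
  (\sum_(i <- r | P i) f i) m = \sum_(i <- r | P i) f i m.
Proof. by apply: (big_morph (fun F : fps R => F m)) => //; rewrite fps_coef0. Qed.

Lemma fps_coefC0 F G : (F * G) 0%N = F 0%N * G 0%N.
Proof. by rewrite fps_coefM big_ord_recl big_ord0 addr0. Qed.

Lemma fps_coefCM a F m : (fpsC a * F) m = a * F m.
Proof.
rewrite fps_coefM big_ord_recl /= subn0 big1 ?addr0 // => i _.
by rewrite mul0r.
Qed.

Fact fpsC_additive : zmod_morphism (@fpsC R).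
Proof. by move=> a b; apply: fps_eqP => -[|m] //=; rewrite subr0. Qed.
Fact fpsC_multiplicative : monoid_morphism (@fpsC R).
Proof.
by split=> // a b; apply: fps_eqP => m; rewrite fps_coefCM /=; case: m => //= m; rewrite mulr0.
Qed.
HB.instance Definition _ := GRing.isZmodMorphism.Build R (fps R) (@fpsC R) fpsC_additive.
HB.instance Definition _ := GRing.isMonoidMorphism.Build R (fps R) (@fpsC R) fpsC_multiplicative.

Lemma fpsC_nat n : fpsC (n%:R : R) = n%:R.
Proof. exact: rmorph_nat. Qed.

Definition fps_of_poly (P : {poly R}) : fps R := Fps (fun k => P`_k).

Fact fps_of_poly_additive : zmod_morphism fps_of_poly.
Proof. by move=> P Q; apply: fps_eqP => m /=; rewrite coefB. Qed.
Fact fps_of_poly_multiplicative : monoid_morphism fps_of_poly.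
Proof.
split; first by apply: fps_eqP => -[|m] /=; rewrite coef1.
by move=> P Q; apply: fps_eqP => m /=; rewrite coefM.
Qed.
HB.instance Definition _ := GRing.isZmodMorphism.Build {poly R} (fps R)
  fps_of_poly fps_of_poly_additive.
HB.instance Definition _ := GRing.isMonoidMorphism.Build {poly R} (fps R)
  fps_of_poly fps_of_poly_multiplicative.

Lemma fps_of_polyX : fps_of_poly 'X = fpsX R.
Proof. by apply: fps_eqP => m /=; rewrite coefX. Qed.

Lemma fps_coefXn n m : (fpsX R ^+ n) m = (m == n)%:R.
Proof. by rewrite -fps_of_polyX -rmorphXn /= coefXn. Qed.

Lemma fps_coefXM F m : (fpsX R * F) m = if m is k.+1 then F k else 0.
Proof.
case: m => [|m]; first by rewrite fps_coefC0 mul0r.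
rewrite fps_coefM !big_ord_recl /= mul0r add0r mul1r big1 ?addr0 ?subSS ?subn0 //.
by move=> i _; rewrite mul0r.
Qed.

(* F lies in (p, pi)^N. *)
Definition inJ (N : nat) (F : fps R) : Prop := forall m, dvp (N - m) (F m).

Lemma inJ_zero N : inJ N 0.
Proof. by move=> m; rewrite fps_coef0; apply: dvp_zero. Qed.

Lemma inJ0n F : inJ 0 F.
Proof. by move=> m; apply: dvp0n. Qed.

Lemma inJD N F G : inJ N F -> inJ N G -> inJ N (F + G).
Proof. by move=> hF hG m; apply: dvpD. Qed.

Lemma inJN N F : inJ N F -> inJ N (- F).
Proof. by move=> hF m; apply: dvpN. Qed.

Lemma inJB N F G : inJ N F -> inJ N G -> inJ N (F - G).
Proof. by move=> hF /inJN; apply: inJD. Qed.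

Lemma inJ_sum N (I : Type) (r : seq I) (P : pred I) (f : I -> fps R) :
  (forall i, P i -> inJ N (f i)) -> inJ N (\sum_(i <- r | P i) f i).
Proof. by move=> h; apply: big_ind => //; [exact: inJ_zero|exact: inJD]. Qed.

Lemma inJ_le M N F : (M <= N)%N -> inJ N F -> inJ M F.
Proof. by move=> MN hF m; apply: dvp_le (hF m); apply: leq_sub2r. Qed.

Lemma inJM M N F G : inJ M F -> inJ N G -> inJ (M + N) (F * G).
Proof.
move=> hF hG m; rewrite fps_coefM; apply: dvp_sum => i _.
apply: dvp_le (dvpM (hF i) (hG (m - i)%N)).
by have := ltn_ord i; lia.
Qed.

Lemma inJ_mull N F G : inJ N G -> inJ N (F * G).
Proof. by move=> h; rewrite -[N]add0n; apply: inJM => //; apply: inJ0n. Qed.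

Lemma inJ_mulr N F G : inJ N F -> inJ N (F * G).
Proof. by move=> h; rewrite mulrC; apply: inJ_mull. Qed.

Lemma inJX N k F : inJ N F -> inJ (N * k) (F ^+ k).
Proof.
move=> h; elim: k => [|k IH]; first by rewrite muln0; apply: inJ0n.
by rewrite exprS mulnS; apply: inJM.
Qed.

Lemma inJC N a : inJ N (fpsC a) <-> dvp N a.
Proof.
split=> [/(_ 0%N)|h [|m]]; rewrite ?subn0 //=; exact: dvp_zero.
Qed.

Lemma inJ_trans N F G H : inJ N (F - G) -> inJ N (G - H) -> inJ N (F - H).
Proof. by move=> h1 h2; have := inJD h1 h2; congr inJ; ring. Qed.

Lemma inJ_sym N F G : inJ N (F - G) -> inJ N (G - F).
Proof. by move/inJN; rewrite opprB. Qed.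

Lemma inJ1 F : inJ 1 F <-> dvp 1 (F 0%N).
Proof.
split=> [/(_ 0%N)//|h [|m]]; first exact: h.
by rewrite subSS sub0n; apply: dvp0n.
Qed.

Lemma inJ_low N F : (forall i, (i < N)%N -> F i = 0) -> inJ N F.
Proof.
move=> h m; have [mN|Nm] := ltnP m N; first by rewrite h //; apply: dvp_zero.
by rewrite (eqP Nm); apply: dvp0n.
Qed.

Definition Jcvg U F : Prop :=
  forall N, exists K, forall k, (K <= k)%N -> inJ N (U k - F).

Lemma eventually_all (P : nat -> nat -> Prop) N :
  (forall m, exists K, forall k, (K <= k)%N -> P m k) ->
  exists K, forall k m, (K <= k)%N -> (m < N)%N -> P m k.
Proof.
move=> h; elim: N => [|N [K hK]]; first by exists 0%N.
have [L hL] := h N; exists (maxn K L) => k m.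
rewrite geq_max => /andP[kK kL]; rewrite ltnS leq_eqVlt => /orP[/eqP ->|mN]; first exact: hL.
exact: hK.
Qed.

(** Membership in (p, pi)^N constrains only the coefficients of index below N, so finitely many
    ranks of convergence are combined; conversely the coefficient of index m in (p, pi)^(N + m) is
    divisible by p^N. *)
Lemma Jcvg_fps_cvg U F : Jcvg U F <-> fps_cvg p U F.
Proof.
split=> h => [m N|N].
  have [K hK] := h (N + m)%N; exists K => k kK.
  by have := hK k kK m; rewrite addnK.
have [K hK] := eventually_all N (fun m => h m N); exists K => k kK m.
have [mN|Nm] := ltnP m N; last by rewrite (eqP Nm); apply: dvp0n.
by apply: dvp_le (hK k m kK mN); apply: leq_subr.
Qed.

Lemma Jcvg_inJ N U F K : Jcvg U F -> (forall k, (K <= k)%N -> inJ N (U k)) -> inJ N F.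
Proof.
move=> hu hK; have [L hL] := hu N; pose k := maxn K L.
have -> : F = U k - (U k - F) by ring.
by apply: inJB; [apply: hK; rewrite leq_maxl | apply: hL; rewrite leq_maxr].
Qed.

Lemma Jcvg_cst F : Jcvg (fun=> F) F.
Proof. by move=> N; exists 0%N => k _; rewrite subrr; apply: inJ_zero. Qed.

Lemma JcvgB U V F G : Jcvg U F -> Jcvg V G -> Jcvg (fun k => U k - V k) (F - G).
Proof.
move=> hu hv N; have [K hK] := hu N; have [L hL] := hv N.
exists (maxn K L) => k; rewrite geq_max => /andP[kK kL].
have := inJB (hK k kK) (hL k kL); congr inJ; ring.
Qed.

Lemma Jcvg_eventually U V F K : (forall k, (K <= k)%N -> U k = V k) ->
  Jcvg U F -> Jcvg V F.
Proof.
move=> e h N; have [L hL] := h N; exists (maxn K L) => k.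
by rewrite geq_max => /andP[kK kL]; rewrite -e //; apply: hL.
Qed.

Lemma inJ_cvgX N F G k : inJ N (F - G) -> inJ N (F ^+ k - G ^+ k).
Proof. by move=> h; rewrite subrXX; apply: inJ_mulr. Qed.

Lemma JcvgX U F k : Jcvg U F -> Jcvg (fun m => U m ^+ k) (F ^+ k).
Proof.
move=> h N; have [K hK] := h N; exists K => m /hK; exact: inJ_cvgX.
Qed.

Hypothesis hR : padic_ring p R.

Lemma inJ_sep F : (forall N, inJ N F) -> F = 0.
Proof.
move=> h; apply: fps_eqP => m; rewrite fps_coef0; apply: (padic_sep hR) => N.
by have := h (N + m)%N m; rewrite addnK.
Qed.

Lemma Jcvg_uniq U F G : Jcvg U F -> Jcvg U G -> F = G.
Proof.
move=> hF hG; apply/eqP; rewrite -subr_eq0; apply/eqP; apply: inJ_sep => N.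
apply: (Jcvg_inJ (JcvgB hF hG) (K := 0%N)) => k _; rewrite subrr; exact: inJ_zero.
Qed.

Lemma fps_lim_eq U F : Jcvg U F -> fps_lim p U = F.
Proof.
move=> /[dup] hF /Jcvg_fps_cvg hF'; rewrite /fps_lim.
case: xgetP => [G _ /= /Jcvg_fps_cvg hG|/(_ F)//].
exact: Jcvg_uniq hG hF.
Qed.

Lemma Jcauchy_cvg U :
  (forall N, exists K, forall k, (K <= k)%N -> inJ N (U k.+1 - U k)) ->
  Jcvg U (fps_lim p U).
Proof.
move=> h.
have cv m : exists l, padic_cvg p (fun k => U k m) l.
  apply: (padic_cpl hR) => N; have [K hK] := h (N + m)%N; exists K => k /hK /(_ m).
  by rewrite addnK.
pose F := Fps (fun m => sval (cid (cv m))).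
have hF : Jcvg U F by apply/Jcvg_fps_cvg => m; apply: (svalP (cid (cv m))).
by rewrite (fps_lim_eq hF).
Qed.

End Filtration.

Arguments inJ p {R}.
Arguments Jcvg p {R}.

(** * Substitution of topologically nilpotent series *)

Section Substitution.
Variables (p : nat) (R : comNzRingType).
Hypothesis hR : padic_ring p R.
Implicit Types (F G P Q : fps R).
Local Notation subst := (@fps_subst p R).

(** Asking that the constant term be divisible by p would be too strict: for a p-th root of unity z,
    the series z (1 + pi) - 1 has constant term z - 1, and only a power of the series falls into (p,
    pi). *)
Definition top_nilp Q : Prop :=
  forall N, exists K, forall k, (K <= k)%N -> inJ p N (Q ^+ k).

Lemma top_nilpP Q k : inJ p 1 (Q ^+ k.+1) -> top_nilp Q.
Proof.
move=> h N; exists (k.+1 * N)%N => m /subnKC <-.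
by rewrite exprD exprM; apply: inJ_mulr; have := inJX N h; rewrite mul1n.
Qed.

Lemma top_nilp_inJ1 Q : inJ p 1 Q -> top_nilp Q.
Proof. by move=> h; apply: (@top_nilpP _ 0); rewrite expr1. Qed.

Definition psum F Q (K : nat) : fps R := \sum_(k < K) fpsC (F k) * Q ^+ k.

Lemma subst_cvg F Q : top_nilp Q -> Jcvg p (psum F Q) (subst F Q).
Proof.
move=> tQ; apply: Jcauchy_cvg => // N; have [K hK] := tQ N; exists K => k /hK h.
rewrite /psum big_ord_recr /= addrAC subrr add0r; exact: inJ_mull.
Qed.

Lemma horner_psum (S : {poly R}) Q K : (size S <= K)%N ->
  (map_poly (@fpsC R) S).[Q] = psum (fps_of_poly S) Q K.
Proof.
move=> hS; rewrite (@horner_coef_wide _ K); last exact: leq_trans (size_poly _ _) hS.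
by apply: eq_bigr => i _; rewrite coef_map.
Qed.

(** Modulo (p, pi)^N only the coefficients of index below K contribute, so F may be replaced by a
    polynomial; [substM] then follows from the multiplicativity of polynomial evaluation. *)
Lemma subst_poly_cong N K F Q (S : {poly R}) : top_nilp Q ->
  (forall i, (i < K)%N -> F i = S`_i) ->
  (forall k, (K <= k)%N -> inJ p N (Q ^+ k)) ->
  inJ p N (subst F Q - (map_poly (@fpsC R) S).[Q]).
Proof.
move=> tQ FS hK.
apply: (Jcvg_inJ (JcvgB (subst_cvg F tQ) (Jcvg_cst p _)) (K := size S)).
move=> k hk; rewrite (horner_psum Q hk) /psum -sumrB; apply: inJ_sum => i _.
rewrite -mulrBl; have [iK|Ki] := ltnP i K; last by apply: inJ_mull; apply: hK.
by rewrite FS // subrr mul0r; apply: inJ_zero.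
Qed.

Lemma substB F G Q : top_nilp Q -> subst (F - G) Q = subst F Q - subst G Q.
Proof.
move=> tQ; apply: (Jcvg_uniq hR (subst_cvg _ tQ)).
apply: (@Jcvg_eventually _ _ _ _ _ 0%N) (JcvgB (subst_cvg F tQ) (subst_cvg G tQ)).
move=> k _; rewrite /psum -sumrB; apply: eq_bigr => i _.
by rewrite fps_coefB rmorphB mulrBl.
Qed.

Lemma substM F G Q : top_nilp Q -> subst (F * G) Q = subst F Q * subst G Q.
Proof.
move=> tQ; apply/eqP; rewrite -subr_eq0; apply/eqP; apply: (inJ_sep hR) => N.
have [K hK] := tQ N.
set S := fps_trunc K F; set T := fps_trunc K G.
have e : inJ p N (subst (F * G) Q - (map_poly (@fpsC R) (S * T)).[Q]).
  apply: (subst_poly_cong (K := K)) => // i iK.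
  rewrite coefM fps_coefM; apply: eq_bigr => j _.
  by rewrite !coef_trunc // (leq_ltn_trans _ iK) ?leq_subr // -ltnS.
have eF : inJ p N (subst F Q - (map_poly (@fpsC R) S).[Q]).
  by apply: (subst_poly_cong (K := K)) => // i iK; rewrite coef_trunc.
have eG : inJ p N (subst G Q - (map_poly (@fpsC R) T).[Q]).
  by apply: (subst_poly_cong (K := K)) => // i iK; rewrite coef_trunc.
move: e; rewrite rmorphM hornerM => e.
have := inJB e (inJD (inJ_mulr (subst G Q) eF) (inJ_mull (map_poly (@fpsC R) S).[Q] eG)).
congr inJ; ring.
Qed.

Lemma substC a Q : top_nilp Q -> subst (fpsC a) Q = fpsC a.
Proof.
move=> tQ; apply: (Jcvg_uniq hR (subst_cvg _ tQ)).
apply: (@Jcvg_eventually _ _ (fun=> fpsC a) _ _ 1%N); last exact: Jcvg_cst.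
move=> [//|k] _; rewrite /psum big_ord_recl /= mulr1 big1 ?addr0 // => i _.
by rewrite rmorph0 mul0r.
Qed.

Lemma subst1 Q : top_nilp Q -> subst 1 Q = 1.
Proof. exact: substC. Qed.

Lemma subst0 Q : top_nilp Q -> subst 0 Q = 0.
Proof. exact: substC. Qed.

Lemma substX Q : top_nilp Q -> subst (fpsX R) Q = Q.
Proof.
move=> tQ; apply: (Jcvg_uniq hR (subst_cvg _ tQ)).
apply: (@Jcvg_eventually _ _ (fun=> Q) _ _ 2%N); last exact: Jcvg_cst.
move=> [|[|k]] // _; rewrite /psum !big_ord_recl /= mulr0n rmorph0 mul0r add0r.
rewrite mulr1n rmorph1 mul1r expr1 big1 ?addr0 // => i _.
by rewrite mul0r.
Qed.

Lemma substD F G Q : top_nilp Q -> subst (F + G) Q = subst F Q + subst G Q.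
Proof.
move=> tQ; rewrite -[G in LHS]opprK substB //; congr (_ + _).
by rewrite -[- G]add0r substB // subst0 // add0r opprK.
Qed.

Lemma subst_sum (I : Type) (r : seq I) (P : pred I) (f : I -> fps R) Q : top_nilp Q ->
  subst (\sum_(i <- r | P i) f i) Q = \sum_(i <- r | P i) subst (f i) Q.
Proof.
move=> tQ; apply: (big_morph (fun F => subst F Q)); last exact: subst0.
by move=> F G; apply: substD.
Qed.

Lemma substXn F k Q : top_nilp Q -> subst (F ^+ k) Q = subst F Q ^+ k.
Proof.
move=> tQ; elim: k => [|k IH]; first exact: subst1.
by rewrite !exprS substM // IH.
Qed.

Lemma subst_cont Q N : top_nilp Q ->
  exists M, forall F, inJ p M F -> inJ p N (subst F Q).
Proof.
(* For i < K the coefficient F_i is divisible by p^(N + K - i), hence by p^N; for i >= K the power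
   Q^i already lies in (p, pi)^N. *)
move=> tQ; have [K hK] := tQ N; exists (N + K)%N => F hF.
apply: (Jcvg_inJ (subst_cvg F tQ) (K := 0%N)) => k _.
apply: inJ_sum => i _; have [iK|Ki] := ltnP i K; last by apply: inJ_mull; apply: hK.
apply: inJ_mulr; apply/inJC; apply: dvp_le (hF i); lia.
Qed.

Lemma subst_lim U F Q : top_nilp Q ->
  Jcvg p U F -> Jcvg p (fun k => subst (U k) Q) (subst F Q).
Proof.
move=> tQ h N; have [M hM] := subst_cont N tQ; have [K hK] := h M.
by exists K => k /hK /hM; rewrite substB.
Qed.

Lemma subst_comp F P Q : top_nilp P -> top_nilp Q -> top_nilp (subst P Q) ->
  subst (subst F P) Q = subst F (subst P Q).
Proof.
move=> tP tQ tPQ; apply: (Jcvg_uniq hR (subst_lim tQ (subst_cvg F tP))).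
apply: (@Jcvg_eventually _ _ _ _ _ 0%N) (subst_cvg F tPQ).
move=> k _; rewrite subst_sum //; apply: eq_bigr => i _.
by rewrite substM // substC // substXn.
Qed.

Lemma subst_cong N F P Q : top_nilp P -> top_nilp Q -> inJ p N (P - Q) ->
  inJ p N (subst F P - subst F Q).
Proof.
move=> tP tQ h.
apply: (Jcvg_inJ (JcvgB (subst_cvg F tP) (subst_cvg F tQ)) (K := 0%N)) => k _.
rewrite /psum -sumrB; apply: inJ_sum => i _; rewrite -mulrBr.
by apply: inJ_mull; apply: inJ_cvgX.
Qed.

End Substitution.

(** * Power series as measures on Z_p *)

Lemma prime_exprD (S : comNzRingType) (p : nat) (x y : S) : prime p ->
  exists z, (x + y) ^+ p = x ^+ p + y ^+ p + p%:R * z.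
Proof.
case: p => // p pr; rewrite exprDn big_ord_recl big_ord_recr /= subn0 bin0 subnn binn.
exists (\sum_(i < p) (x ^+ (p.+1 - bump 0 i) * y ^+ bump 0 i) *+ ('C(p.+1, bump 0 i) %/ p.+1)).
have -> : \sum_(i < p) (x ^+ (p.+1 - bump 0 i) * y ^+ bump 0 i) *+ 'C(p.+1, bump 0 i) =
  p.+1%:R * (\sum_(i < p) (x ^+ (p.+1 - bump 0 i) * y ^+ bump 0 i) *+ ('C(p.+1, bump 0 i) %/ p.+1)).
  rewrite mulr_sumr; apply: eq_bigr => i _.
  rewrite mulr_natl -mulrnA divnK //; apply: prime_dvd_bin => //.
  by rewrite /bump /= add1n ltnS ltn_ord.
by rewrite !mulr1n !mulr1 !mul1r addrCA [in RHS]addrC.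
Qed.

Lemma prime_exprX (S : comNzRingType) (p n : nat) (x : S) : prime p -> odd p ->
  exists z, (x - 1) ^+ (p ^ n) = x ^+ (p ^ n) - 1 + p%:R * z.
Proof.
move=> pr p_odd; elim: n => [|n [z IH]].
  by exists 0; rewrite !expr1 mulr0 addr0.
have [w hw] := prime_exprD (x ^+ (p ^ n)) (-1) pr.
have [v hv] := prime_exprD (x ^+ (p ^ n) - 1) (p%:R * z) pr.
rewrite expnSr !exprM IH hv hw -signr_odd p_odd expr1.
exists (w + v + p%:R ^+ p.-1 * z ^+ p).
rewrite !mulrDr [p%:R * (p%:R ^+ _ * _)]mulrA -exprS prednK ?prime_gt0 // exprMn.
ring.
Qed.

Lemma sum_ord_mul (V : nmodType) (q s : nat) (f : nat -> V) :
  \sum_(x < q * s) f x = \sum_(j < q) \sum_(t < s) f (j + q * t)%N.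
Proof.
rewrite exchange_big /=; elim: s => [|s IH].
  by rewrite muln0 !big_ord0.
rewrite big_ord_recr /= -IH mulnSr -!(big_mkord xpredT) /=.
rewrite (big_cat_nat (n := q * s)) ?leq_addr //=; congr (_ + _).
rewrite -{1}[(q * s)%N]add0n big_addn addKn big_mkord; apply: eq_bigr => i _ //.
Qed.

Section Measures.
Variables (p : nat) (R : comNzRingType).
Hypotheses (pr : prime p) (p_odd : odd p) (hR : padic_ring p R).
Implicit Types (F G H : fps R) (P : {poly R}).
Local Notation u := (1 + fpsX R).
Local Notation dvp := (@dvp p R).
Local Notation inJ := (@inJ p R).

(** In x^p - 1 = (x - 1) (1 + x + ... + x^(p-1)) the second factor is congruent to p modulo x - 1,
    hence lies in (p, pi). *)
Lemma inJ_pow_sub1 k (x : fps R) : inJ k.+1 (x - 1) -> inJ k.+2 (x ^+ p - 1).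
Proof.
move=> h; rewrite subrX1 -[k.+2]addn1; apply: inJM => //.
have -> : \sum_(i < p) x ^+ i = \sum_(i < p) (x ^+ i - 1) + p%:R.
  by rewrite sumrB sumr_const card_ord subrK.
apply: inJD; last by rewrite -fpsC_nat; apply/inJC; apply: dvp_p.
apply: inJ_sum => i _; rewrite subrX1; apply: inJ_mulr.
by apply: inJ_le h.
Qed.

Lemma inJ_upow m : inJ m.+1 (u ^+ (p ^ m) - 1).
Proof.
elim: m => [|m IH]; last by rewrite expnSr exprM; apply: inJ_pow_sub1.
by rewrite expr1 addrC addKr; apply/inJ1; exists 0; rewrite mulr0.
Qed.

(** Continuity of i |-> u^i for the p-adic topology on exponents: the difference is a multiple of
    u^(p^m) - 1. It underlies both the powers u^a with a in Z_p and the approximation of series by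
    sums of Dirac measures. *)
Lemma inJ_upow_cong m i j : i = j %[mod p ^ m] -> inJ m.+1 (u ^+ i - u ^+ j).
Proof.
wlog ij : i j / (j <= i)%N.
  by case: (leqP j i) => [|/ltnW] h W e; [|apply: inJ_sym]; apply: W.
move=> /eqP; rewrite eqn_mod_dvd // => /dvdnP[t e].
rewrite -(subnKC ij) e exprD -[X in _ - X]mulr1 -mulrBr; apply: inJ_mull.
rewrite mulnC exprM subrX1; apply: inJ_mulr; exact: inJ_upow.
Qed.

(** * Masses on residue classes *)

Definition class_sum n j (P : {poly R}) : R :=
  \sum_(i < size P) (i == j %[mod p ^ n])%:R * P`_i.

Lemma class_sum_wide M n j P : (size P <= M)%N ->
  class_sum n j P = \sum_(i < M) (i == j %[mod p ^ n])%:R * P`_i.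
Proof.
move=> /subnKC <-; elim: (M - size P)%N => [|k IH]; first by rewrite addn0.
rewrite addnS big_ord_recr /= -IH [P`_(_ + _)]nth_default ?leq_addr //.
by rewrite mulr0 addr0.
Qed.

Lemma class_sumD n j P (Q : {poly R}) : class_sum n j (P + Q) = class_sum n j P + class_sum n j Q.
Proof.
pose M := maxn (size P) (size Q).
rewrite !(@class_sum_wide M) ?leq_maxl ?leq_maxr ?size_polyD //.
by rewrite -big_split /=; apply: eq_bigr => i _; rewrite coefD mulrDr.
Qed.

Lemma class_sumZ n j a P : class_sum n j (a *: P) = a * class_sum n j P.
Proof.
rewrite !(@class_sum_wide (size P)) ?size_scale_leq // mulr_sumr.
by apply: eq_bigr => i _; rewrite coefZ mulrCA.
Qed.

Lemma class_sumN n j P : class_sum n j (- P) = - class_sum n j P.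
Proof. by rewrite -scaleN1r class_sumZ mulN1r. Qed.

Lemma class_sum_natl n j k P : class_sum n j (k%:R * P) = k%:R * class_sum n j P.
Proof. by rewrite mulr_natl -(@scaler_nat R) class_sumZ. Qed.

Lemma class_sum0 n j : class_sum n j 0 = 0.
Proof. by rewrite /class_sum size_poly0 big_ord0. Qed.

Lemma class_sum_sum n j (I : Type) (r : seq I) (P : pred I) (f : I -> {poly R}) :
  class_sum n j (\sum_(i <- r | P i) f i) = \sum_(i <- r | P i) class_sum n j (f i).
Proof. exact: (big_morph _ (class_sumD n j) (class_sum0 n j)). Qed.

Lemma class_sumXn n j k : class_sum n j 'X^k = (k == j %[mod p ^ n])%:R.
Proof.
rewrite /class_sum size_polyXn big_ord_recr /= big1 ?add0r => [|i _].
  by rewrite coefXn eqxx mulr1.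
by rewrite coefXn [i == k :> nat]ltn_eqF ?mulr0.
Qed.

Lemma class_sum_period n j P : class_sum n j ('X^(p ^ n) * P) = class_sum n j P.
Proof.
rewrite -[P]coefK poly_def mulr_sumr !class_sum_sum; apply: eq_bigr => i _.
rewrite -scalerAr !class_sumZ -exprD !class_sumXn; congr (_ * (_ : bool)%:R).
by rewrite modnDl.
Qed.

(* The mass of pi^k = (u - 1)^k on j + p^n Z_p, by expansion into Dirac measures u^i. *)
Definition class_coef n j k : R := class_sum n j (('X - 1) ^+ k).

(** Write (X - 1)^(p^n) = X^(p^n) - 1 + p h. Multiplication by X^(p^n) does not change sums over
    classes modulo p^n, so each factor (X - 1)^(p^n) contributes a factor p. Hence the masses of
    pi^k tend to 0 and the mass of any series converges. *)
Lemma class_coef_dvp N n j k : (p ^ n * N <= k)%N -> dvp N (class_coef n j k).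
Proof.
move=> /subnKC <-; rewrite /class_coef exprD exprM.
have [h ->] := prime_exprX n ('X : {poly R}) pr p_odd.
elim: N (_ ^+ (k - _)%N) => [|N IH] S; first exact: dvp0n.
rewrite exprS -mulrA mulrDl class_sumD mulrBl mul1r class_sumD.
rewrite class_sum_period class_sumN subrr add0r -mulrA.
rewrite class_sum_natl -[N.+1]add1n; apply: dvpM; first exact: dvp_p.
by rewrite mulrCA; apply: IH.
Qed.

(* The mass on j + p^n Z_p of the measure F; j is any representative of the class. *)
Definition mass n F j : R :=
  xget 0 [set l | padic_cvg p (fun K => \sum_(k < K) F k * class_coef n j k) l]%classic.

Lemma mass_cvg n F j :
  padic_cvg p (fun K => \sum_(k < K) F k * class_coef n j k) (mass n F j).
Proof.
rewrite /mass; case: xgetP => [l -> //|none].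
have [l hl] : exists l, padic_cvg p (fun K => \sum_(k < K) F k * class_coef n j k) l.
  apply: (padic_cpl hR) => N; exists (p ^ n * N)%N => k hk.
  rewrite big_ord_recr /= addrAC subrr add0r; apply: dvp_mull.
  exact: class_coef_dvp.
by case: (none l).
Qed.

Lemma mass_eq n F j l :
  padic_cvg p (fun K => \sum_(k < K) F k * class_coef n j k) l -> mass n F j = l.
Proof. exact: (padic_cvg_uniq hR (mass_cvg n F j)). Qed.

Lemma massB n j F G : mass n (F - G) j = mass n F j - mass n G j.
Proof.
apply: mass_eq; move=> N; have [K hK] := padic_cvgB (mass_cvg n F j) (mass_cvg n G j) N.
exists K => k /hK; congr dvp; congr (_ - _); rewrite -sumrB.
by apply: eq_bigr => i _; rewrite fps_coefB mulrBl.
Qed.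

Lemma massZ n j a F : mass n (fpsC a * F) j = a * mass n F j.
Proof.
apply: mass_eq; move=> N; have [K hK] := mass_cvg n F j N.
exists K => k /hK h.
have -> : \sum_(i < k) (fpsC a * F) i * class_coef n j i =
   a * \sum_(i < k) F i * class_coef n j i.
  by rewrite mulr_sumr; apply: eq_bigr => i _; rewrite fps_coefCM mulrA.
by rewrite -mulrBr; apply: dvp_mull.
Qed.

(** For k < p^n N the hypothesis makes F_k divisible by p^N; for the other k the mass of pi^k is. *)
Lemma mass_cont N n j F : inJ (N + p ^ n * N) F -> dvp N (mass n F j).
Proof.
move=> hF; apply: (padic_cvg_dvp (mass_cvg n F j) (K := 0%N)) => K _.
apply: dvp_sum => k _; have [kq|qk] := ltnP k (p ^ n * N).
  rewrite mulrC; apply: dvp_mull; apply: dvp_le (hF k); lia.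
by apply: dvp_mull; apply: class_coef_dvp.
Qed.

(** [P] is a polynomial in pi, while in [class_sum] the variable stands for u; the composition with
    X - 1 is this change of variable. *)
Lemma mass_poly n j P : mass n (fps_of_poly P) j = class_sum n j (P \Po ('X - 1)).
Proof.
apply: mass_eq; apply: (@padic_cvg_eventually _ _ _ _ (size P)) => K hK.
rewrite comp_polyE class_sum_sum -(subnKC hK).
elim: (K - size P)%N => [|k IH]; last first.
  by rewrite addnS big_ord_recr /= IH nth_default ?leq_addr // mul0r addr0.
by rewrite addn0; apply: eq_bigr => i _; rewrite class_sumZ.
Qed.

Lemma mass_upow n j i : mass n (u ^+ i) j = (i == j %[mod p ^ n])%:R.
Proof.
have -> : u ^+ i = fps_of_poly ((1 + 'X) ^+ i).
  by rewrite rmorphXn rmorphD /= rmorph1 fps_of_polyX.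
rewrite mass_poly rmorphXn /= rmorphD /= comp_polyX rmorph1 /= -[1]/(1%:P).
by rewrite [1%:P + _]addrC subrK class_sumXn.
Qed.

Lemma mass_period n F i j : i = j %[mod p ^ n] -> mass n F i = mass n F j.
Proof.
move=> ij; rewrite /mass; congr xget; apply: funext => l; congr (padic_cvg p _ l).
apply: funext => K; apply: eq_bigr => k _; congr (_ * _).
by apply: eq_bigr => t _; rewrite ij.
Qed.

(** Functionals such as masses are made into operators by composing with [fpsC], so that one notion
    covers masses, products and substitutions. *)
Record cont_linear (T : fps R -> fps R) : Prop := ContLinear {
  cont_linearB : forall F G, T (F - G) = T F - T G;
  cont_linearZ : forall a F, T (fpsC a * F) = fpsC a * T F;
  cont_linear_cont : forall N, exists M, forall F, inJ M F -> inJ N (T F)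
}.

Lemma cont_linear0 T : cont_linear T -> T 0 = 0.
Proof. by move=> h; have := cont_linearB h 0 0; rewrite !subrr. Qed.

Lemma cont_linearD T F G : cont_linear T -> T (F + G) = T F + T G.
Proof.
move=> h; rewrite -[G in LHS]opprK (cont_linearB h) -[- G]add0r.
by rewrite (cont_linearB h) (cont_linear0 h) add0r opprK.
Qed.

Lemma cont_linear_sum T (I : Type) (r : seq I) (P : pred I) (f : I -> fps R) :
  cont_linear T ->
  T (\sum_(i <- r | P i) f i) = \sum_(i <- r | P i) T (f i).
Proof.
move=> h; apply: (big_morph T) => [F G|]; [exact: cont_linearD|exact: cont_linear0].
Qed.

Lemma cont_linear_id : cont_linear id.
Proof. by split=> // N; exists N. Qed.

Lemma cont_linear_comp T S : cont_linear T -> cont_linear S -> cont_linear (T \o S).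
Proof.
move=> hT hS; split=> [F G|a F|N] /=.
- by rewrite (cont_linearB hS) (cont_linearB hT).
- by rewrite (cont_linearZ hS) (cont_linearZ hT).
have [M hM] := cont_linear_cont hT N; have [L hL] := cont_linear_cont hS M.
by exists L => F /hL /hM.
Qed.

Lemma cont_linear_mul G : cont_linear ( *%R G).
Proof.
split=> [F H|a F|N]; [exact: mulrBr|exact: mulrCA|exists N => F].
exact: inJ_mull.
Qed.

Lemma cont_linear_add T S : cont_linear T -> cont_linear S ->
  cont_linear (fun F => T F + S F).
Proof.
move=> hT hS; split=> [F G|a F|N] /=.
- by rewrite (cont_linearB hS) (cont_linearB hT) opprD addrACA.
- by rewrite (cont_linearZ hS) (cont_linearZ hT) mulrDr.
have [M hM] := cont_linear_cont hT N; have [L hL] := cont_linear_cont hS N.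
exists (maxn M L) => F hF; apply: inJD; [apply: hM|apply: hL]; apply: inJ_le hF.
  exact: leq_maxl.
exact: leq_maxr.
Qed.

Lemma cont_linear_opp T : cont_linear T -> cont_linear (fun F => - T F).
Proof.
move=> hT; split=> [F G|a F|N] /=.
- by rewrite (cont_linearB hT) opprB opprK addrC.
- by rewrite (cont_linearZ hT) mulrN.
by have [M hM] := cont_linear_cont hT N; exists M => F /hM; apply: inJN.
Qed.

Lemma cont_linear_zero : cont_linear (fun=> 0).
Proof.
split=> [F G|a F|N]; rewrite ?subrr ?mulr0 //.
by exists 0%N => F _; apply: inJ_zero.
Qed.

Lemma cont_linear_bigsum (I : Type) (r : seq I) (T : I -> fps R -> fps R) :
  (forall i, cont_linear (T i)) -> cont_linear (fun F => \sum_(i <- r) T i F).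
Proof.
move=> h; elim: r => [|i r IH].
  have -> : (fun F => \sum_(i <- [::]) T i F) = fun=> 0.
    by apply: funext => F; rewrite big_nil.
  exact: cont_linear_zero.
have -> : (fun F => \sum_(j <- i :: r) T j F) =
          (fun F => T i F + \sum_(j <- r) T j F).
  by apply: funext => F; rewrite big_cons.
exact: cont_linear_add.
Qed.

Lemma cont_linear_mass n j : cont_linear (fun F => fpsC (mass n F j)).
Proof.
split=> [F G|a F|N]; rewrite ?massB ?massZ ?rmorphB ?rmorphM //.
by exists (N + p ^ n * N)%N => F /mass_cont h; apply/inJC.
Qed.

Lemma cont_linear_coef0 : cont_linear (fun F => fpsC (F 0%N)).
Proof.
split=> [F G|a F|N]; rewrite ?fps_coefB ?fps_coefCM ?rmorphB ?rmorphM //.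
by exists N => F h; apply/inJC; have := h 0%N; rewrite subn0.
Qed.

Lemma cont_linear_subst Q : top_nilp p Q -> cont_linear (fun F => fps_subst p F Q).
Proof.
move=> tQ; split=> [F G|a F|N]; rewrite ?substB ?substM ?substC //.
exact: subst_cont.
Qed.

(* The powers of 1 + pi span a dense submodule. *)
Lemma cont_linear_inJ T N : cont_linear T -> (forall i, inJ N (T (u ^+ i))) ->
  forall F, inJ N (T F).
Proof.
move=> hT hu F.
(* Since pi = u - 1, a product pi^k u^i reduces to powers of u by induction on k. *)
have hX k : forall i, inJ N (T (fpsX R ^+ k * u ^+ i)).
  elim: k => [|k IH] i; first by rewrite mul1r.
  have -> : fpsX R ^+ k.+1 * u ^+ i = fpsX R ^+ k * u ^+ i.+1 - fpsX R ^+ k * u ^+ i.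
    by rewrite !exprS; ring.
  by rewrite (cont_linearB hT); apply: inJB.
have [M hM] := cont_linear_cont hT N.
pose S := \sum_(k < M) fpsC (F k) * fpsX R ^+ k.
have FS : inJ M (F - S).
  apply: inJ_low => i iM; rewrite fps_coefB fps_coef_sum (bigD1 (Ordinal iM)) // big1.
    by rewrite Monoid.mulm1 fps_coefCM fps_coefXn eqxx mulr1 subrr.
  move=> k ki; rewrite fps_coefCM fps_coefXn; case: eqP => [e|_]; last by rewrite mulr0.
  by case/eqP: ki; apply: val_inj.
have -> : T F = T (F - S) + T S by rewrite (cont_linearB hT) subrK.
apply: inJD; first exact: hM.
rewrite cont_linear_sum //; apply: inJ_sum => k _; rewrite (cont_linearZ hT).
by apply: inJ_mull; have := hX k 0%N; rewrite mulr1.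
Qed.

Lemma cont_linear_eq T S : cont_linear T -> cont_linear S ->
  (forall i, T (u ^+ i) = S (u ^+ i)) -> T =1 S.
Proof.
move=> hT hS e F; apply/eqP; rewrite -subr_eq0; apply/eqP; apply: (inJ_sep hR) => N.
apply: (cont_linear_inJ (T := fun F => T F - S F)) => [|i].
  exact: cont_linear_add hT (cont_linear_opp hS).
by rewrite e subrr; apply: inJ_zero.
Qed.

Lemma fpsC_inj : injective (@fpsC R).
Proof. by move=> a b /(congr1 (fun F : fps R => F 0%N)). Qed.

Lemma mass0 n j : mass n 0 j = 0.
Proof. by apply: fpsC_inj; rewrite (cont_linear0 (cont_linear_mass n j)) rmorph0. Qed.

Lemma massD n j F G : mass n (F + G) j = mass n F j + mass n G j.
Proof.
apply: fpsC_inj; rewrite rmorphD; exact: (cont_linearD _ _ (cont_linear_mass n j)).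
Qed.

Lemma mass_sum n j (I : Type) (r : seq I) (P : pred I) (f : I -> fps R) :
  mass n (\sum_(i <- r | P i) f i) j = \sum_(i <- r | P i) mass n (f i) j.
Proof. exact: (big_morph (fun F => mass n F j) (@massD n j) (mass0 n j)). Qed.

Lemma mass_lim n j U F : Jcvg p U F ->
  padic_cvg p (fun k => mass n (U k) j) (mass n F j).
Proof.
move=> h N; have [K hK] := h (N + p ^ n * N)%N; exists K => k /hK.
by rewrite -massB; apply: mass_cont.
Qed.

Lemma pn_gt0 n : (0 < p ^ n)%N.
Proof. by rewrite expn_gt0 prime_gt0. Qed.

Lemma sum_class (V : nmodType) q i (f : nat -> V) : (0 < q)%N ->
  \sum_(j < q) (f j *+ (i == j %[mod q])) = f (i %% q)%N.
Proof.
move=> q0; rewrite (bigD1 (Ordinal (ltn_pmod i q0))) //= modn_mod eqxx mulr1n.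
rewrite big1 ?addr0 // => j ji; case: eqP => // e; case/eqP: ji; apply: val_inj.
by rewrite /= e modn_small.
Qed.

Lemma mass_approx n F : inJ n.+1 (F - \sum_(j < p ^ n) fpsC (mass n F j) * u ^+ j).
Proof.
apply: (cont_linear_inJ
  (T := fun F => F + (- \sum_(j < p ^ n) fpsC (mass n F j) * u ^+ j))) => [|i].
  apply: cont_linear_add; first exact: cont_linear_id.
  apply: cont_linear_opp; apply: cont_linear_bigsum => j.
  have := cont_linear_comp (cont_linear_mul (u ^+ j)) (cont_linear_mass n j).
  by congr cont_linear; apply: funext => H /=; rewrite mulrC.
(* On u^i the sum collapses to the single term u^(i mod p^n), which is congruent to u^i. *)
rewrite (eq_bigr (fun j : 'I_(p ^ n) => u ^+ j *+ (i == j %[mod p ^ n]))) => [|j _].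
  rewrite (sum_class i (fun j => u ^+ j)) ?pn_gt0 //.
  by apply: inJ_upow_cong; rewrite modn_mod.
by rewrite mass_upow fpsC_nat mulr_natl.
Qed.

(** Applied at arbitrarily large levels, [mass_approx] puts F in every (p, pi)^N. The threshold [n0]
    allows comparisons that make sense only from some level on. *)
Lemma mass_inj n0 F : (forall n j, (n0 <= n)%N -> mass n F j = 0) -> F = 0.
Proof.
move=> h; apply: (inJ_sep hR) => N; pose n := maxn n0 N.
apply: (@inJ_le _ _ _ n.+1); first by rewrite leqW ?leq_maxr.
have := mass_approx n F; rewrite big1 ?subr0 // => j _.
by rewrite h ?leq_maxl // rmorph0 mul0r.
Qed.

Lemma mass_inj_eq n0 F G :
  (forall n j, (n0 <= n)%N -> mass n F j = mass n G j) -> F = G.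
Proof.
move=> h; apply/eqP; rewrite -subr_eq0; apply/eqP; apply: (mass_inj (n0 := n0)).
by move=> n j hn; rewrite massB h ?subrr.
Qed.

Lemma mass_ext n j m k (T : fps R -> fps R) : cont_linear T ->
  (forall i, mass n (T (u ^+ i)) j = mass m (u ^+ i) k) ->
  forall F, mass n (T F) j = mass m F k.
Proof.
move=> hT e F; apply: fpsC_inj.
apply: (cont_linear_eq (cont_linear_comp (cont_linear_mass n j) hT)
          (cont_linear_mass m k)) => i /=.
by rewrite e.
Qed.

Lemma mass_step n F j : mass n F j = \sum_(t < p) mass n.+1 F (j + p ^ n * t)%N.
Proof.
apply: fpsC_inj; rewrite rmorph_sum /=.
apply: (cont_linear_eq (cont_linear_mass n j)
         (cont_linear_bigsum _ (fun t : 'I_p => cont_linear_mass n.+1 (j + p ^ n * t)))) => i.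
rewrite -rmorph_sum /=; congr fpsC; rewrite mass_upow.
under eq_bigr do rewrite mass_upow.
have [e|ne] := eqVneq (i %% p ^ n)%N (j %% p ^ n)%N; last first.
  rewrite big1 // => t _; case: eqP => // e'; case/negP: ne; apply/eqP.
  have d : (p ^ n %| p ^ n.+1)%N by rewrite dvdn_exp2l.
  by rewrite -(modn_dvdm i d) e' (modn_dvdm _ d) -modnDmr modnMr addn0.
(* [a] represents the difference of the quotients of i and j by p^n, modulo p; the added multiple of
   p keeps the natural subtraction exact. *)
pose a := (i %/ p ^ n + p * (j %/ p ^ n) - j %/ p ^ n)%N.
have ha : (i %/ p ^ n + p * (j %/ p ^ n) = j %/ p ^ n + a)%N.
  by rewrite /a subnKC // -[leqLHS]add0n leq_add // leq_pmull ?prime_gt0.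
have key t : (i == j + p ^ n * t %[mod p ^ n.+1]) = (a == t %[mod p]).
  rewrite {1}(divn_eq i (p ^ n)) {1}(divn_eq j (p ^ n)) e.
  have -> : (j %/ p ^ n * p ^ n + j %% p ^ n + p ^ n * t =
             (j %/ p ^ n + t) * p ^ n + j %% p ^ n)%N by ring.
  rewrite eqn_modDr expnS -!muln_modl eqn_pmul2r ?pn_gt0 //.
  by rewrite -(eqn_modDr (p * (j %/ p ^ n))) ha -addnA eqn_modDl addnC [(p * _)%N]mulnC modnMDl.
rewrite -[LHS](sum_class a (fun=> 1 : R) (prime_gt0 pr)).
by apply: eq_bigr => t _; rewrite key.
Qed.

(** The series is the limit of the sums U_n of mu_n(j) u^j. Passing from U_n to U_(n+1) moves mass
    only inside classes modulo p^n: this is a small change by [inJ_upow_cong], and it leaves all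
    masses of level at most n fixed. *)
Lemma mass_build (mu : nat -> nat -> R) :
  (forall n i j, i = j %[mod p ^ n] -> mu n i = mu n j) ->
  (forall n j, mu n j = \sum_(t < p) mu n.+1 (j + p ^ n * t)%N) ->
  exists F, forall n j, mass n F j = mu n j.
Proof.
move=> mu_period mu_step.
pose U n : fps R := \sum_(j < p ^ n) fpsC (mu n j) * u ^+ j.
have UD n : U n.+1 - U n = \sum_(j < p ^ n) \sum_(t < p)
    fpsC (mu n.+1 (j + p ^ n * t)%N) * (u ^+ (j + p ^ n * t) - u ^+ j).
  rewrite /U expnSr (sum_ord_mul _ _ (fun j => fpsC (mu n.+1 j) * u ^+ j)) -sumrB.
  apply: eq_bigr => j _; rewrite mu_step rmorph_sum mulr_suml -sumrB.
  by apply: eq_bigr => t _; rewrite mulrBr.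
have cU : Jcvg p U (fps_lim p U).
  apply: (Jcauchy_cvg hR) => N; exists N => n Nn; rewrite UD.
  apply: inJ_sum => j _; apply: inJ_sum => t _; apply: inJ_mull.
  apply: inJ_le (inJ_upow_cong _); first exact: leqW Nn.
  by rewrite -modnDmr modnMr addn0.
exists (fps_lim p U) => n j.
apply: (padic_cvg_uniq hR (mass_lim n j cU)).
apply: (@padic_cvg_eventually _ _ _ _ n) => m /subnKC <-.
elim: (m - n)%N => [|k IH].
  rewrite addn0 /U mass_sum.
  rewrite (eq_bigr (fun i : 'I_(p ^ n) => mu n i *+ (j == i %[mod p ^ n]))).
    by rewrite sum_class ?pn_gt0 //; apply: mu_period; rewrite modn_mod.
  by move=> i _; rewrite massZ mass_upow mulr_natr eq_sym.
rewrite addnS; apply/eqP; rewrite -IH -subr_eq0 -massB UD mass_sum big1 // => i _.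
rewrite mass_sum big1 // => t _; rewrite massZ massB !mass_upow.
have d : (p ^ n %| p ^ (n + k))%N by rewrite dvdn_exp2l ?leq_addr.
have -> : (i + p ^ (n + k) * t = i %[mod p ^ n])%N.
  by rewrite -modnDmr -modnMml (eqP d) mul0n mod0n addn0.
by rewrite subrr mulr0.
Qed.

(** * Decomposition along the classes modulo p^n *)

Lemma inJ1_upow_sub1 i : inJ 1 (u ^+ i - 1).
Proof. by have := @inJ_upow_cong 0 i 0; apply; rewrite !modn1. Qed.

Lemma top_nilp_upow i : top_nilp p (u ^+ i - 1).
Proof. exact: top_nilp_inJ1 (inJ1_upow_sub1 i). Qed.

Lemma subst_u F : top_nilp p (F - 1) -> fps_subst p u (F - 1) = F.
Proof. by move=> tF; rewrite substD // subst1 // substX // addrC subrK. Qed.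

Lemma subst_upow_sub1 q m :
  fps_subst p (u ^+ m - 1) (u ^+ q - 1) = u ^+ (q * m) - 1.
Proof.
have tn := top_nilp_upow q.
by rewrite substB // subst1 // substXn // subst_u // exprM.
Qed.

Local Notation frob q F := (fps_subst p F (u ^+ q - 1)).

(** On measures, G |-> u^j phi^n(G) is the push-forward along x |-> j + p^n x, as its effect u^i |->
    u^(j + p^n i) shows. *)
Lemma mass_frob n m j G x : (j < p ^ n)%N ->
  mass (m + n) (u ^+ j * frob (p ^ n) G) x =
    ((x %% p ^ n)%N == j)%:R * mass m G (x %/ p ^ n)%N.
Proof.
move=> jq; have hT : cont_linear (fun F => u ^+ j * frob (p ^ n) F).
  exact: cont_linear_comp (cont_linear_mul _) (cont_linear_subst (top_nilp_upow _)).
have Tu i : u ^+ j * frob (p ^ n) (u ^+ i) = u ^+ (j + p ^ n * i).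
  by rewrite substXn ?subst_u ?exprD ?exprM //; exact: top_nilp_upow.
have [e|ne] := eqVneq; last first.
  rewrite mul0r; apply: fpsC_inj; rewrite rmorph0.
  apply: (cont_linear_eq (cont_linear_comp (cont_linear_mass _ _) hT) cont_linear_zero).
  move=> i /=; rewrite Tu mass_upow; case: eqP => [h|_]; last by rewrite rmorph0.
  case/eqP: ne; have d : (p ^ n %| p ^ (m + n))%N by rewrite dvdn_exp2l ?leq_addl.
  by rewrite -(modn_dvdm x d) -h (modn_dvdm _ d) -modnDmr modnMr addn0 modn_small.
rewrite mul1r; apply: (mass_ext hT) => i; rewrite Tu !mass_upow; congr (_ : bool)%:R.
rewrite {1}(divn_eq x (p ^ n)) e [(j + _)%N]addnC eqn_modDr expnD mulnC.
by rewrite -!muln_modl eqn_pmul2r ?pn_gt0.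
Qed.

(** G_j is the restriction of F to j + p^n Z_p, pulled back along x |-> j + p^n x. The two sides are
    compared at levels at least n, where [mass_frob] applies. *)
Lemma frob_decomposition n F : exists G : nat -> fps R,
  (forall j m i, (j < p ^ n)%N -> mass m (G j) i = mass (m + n) F (j + p ^ n * i)) /\
  F = \sum_(j < p ^ n) u ^+ j * frob (p ^ n) (G j).
Proof.
have bG j : exists G, forall m i, mass m G i = mass (m + n) F (j + p ^ n * i).
  apply: mass_build => [m i i' e|m i].
    apply: mass_period; apply/eqP; rewrite eqn_modDl addnC expnD.
    by rewrite -!muln_modr e.
  rewrite mass_step addSn; apply: eq_bigr => t _; congr mass.
  by rewrite expnD; ring.
pose G j := sval (cid (bG j)); exists G.
have GP j m i : mass m (G j) i = mass (m + n) F (j + p ^ n * i).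
  exact: (svalP (cid (bG j))).
split=> [j m i _|]; first exact: GP.
apply: (mass_inj_eq (n0 := n)) => k x /subnK <-; move: (k - n)%N => m.
rewrite mass_sum (eq_bigr (fun j : 'I_(p ^ n) =>
   mass m (G j) (x %/ p ^ n)%N *+ (x == j %[mod p ^ n]))) => [|j _].
  rewrite (sum_class x (fun j => mass m (G j) _)) ?pn_gt0 // GP.
  by congr mass; rewrite {1}(divn_eq x (p ^ n)); ring.
by rewrite mass_frob // mulr_natl [(j %% _)%N]modn_small.
Qed.

Lemma frob_inj n : injective (fun F => frob (p ^ n) F).
Proof.
move=> F G e; apply: (mass_inj_eq (n0 := 0)) => m x _.
have := mass_frob m _ (p ^ n * x)%N (pn_gt0 n); move=> h.
have := congr1 (fun H => mass (m + n) (u ^+ 0 * H) (p ^ n * x)%N) e.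
by rewrite /= !h modnMr eqxx !mul1r mulKn ?pn_gt0.
Qed.

(** The total mass is the value at pi = 0, where every u^i equals 1. *)
Lemma mass0E F x : mass 0 F x = F 0%N.
Proof.
apply: fpsC_inj; apply: (cont_linear_eq (cont_linear_mass 0 x) cont_linear_coef0) => i.
rewrite mass_upow !modn1 eqxx; congr fpsC.
by elim: i => // i IH; rewrite exprS fps_coefC0 -IH mulr1 fps_coefD /= addr0.
Qed.

Lemma mass_shift n k F x : mass n (u ^+ k * F) (x + k) = mass n F x.
Proof.
apply: (mass_ext (cont_linear_mul _)) => i.
by rewrite -exprD !mass_upow addnC eqn_modDr.
Qed.

(* The power series which correspond to measures carried by the units of Z_p. *)
Definition unit_supported F : Prop := forall n j, mass n.+1 F (p * j) = 0.

Lemma unit_supportedD F G :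
  unit_supported F -> unit_supported G -> unit_supported (F + G).
Proof. by move=> hF hG n j; rewrite massD hF hG addr0. Qed.

Lemma unit_supportedB F G :
  unit_supported F -> unit_supported G -> unit_supported (F - G).
Proof. by move=> hF hG n j; rewrite massB hF hG subr0. Qed.

Lemma unit_supportedZ a F : unit_supported F -> unit_supported (fpsC a * F).
Proof. by move=> hF n j; rewrite massZ hF mulr0. Qed.

Lemma unit_supported_sum (I : Type) (r : seq I) (P : pred I) (f : I -> fps R) :
  (forall i, P i -> unit_supported (f i)) -> unit_supported (\sum_(i <- r | P i) f i).
Proof.
move=> h; apply: big_ind => //; [move=> n j; exact: mass0|exact: unit_supportedD].
Qed.

Lemma unit_supported_lim U F : Jcvg p U F -> (forall k, unit_supported (U k)) ->
  unit_supported F.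
Proof.
move=> hU h n j; apply: (padic_cvg_uniq hR (mass_lim n.+1 (p * j) hU)).
by apply: (@padic_cvg_eventually _ _ _ _ 0) => k _; apply: h.
Qed.

Lemma unit_supported_large n0 F :
  (forall n j, (n0 <= n)%N -> mass n.+1 F (p * j) = 0) -> unit_supported F.
Proof.
elim: n0 => [|n0 IH] h; first by move=> n j; apply: h.
apply: IH => n j; rewrite leq_eqVlt => /orP[/eqP <-|]; last exact: h.
rewrite mass_step big1 // => t _.
have -> : (p * j + p ^ n0.+1 * t = p * (j + p ^ n0 * t))%N by rewrite expnS; ring.
exact: h.
Qed.

(** As n > 0, divisibility by p is constant on each class modulo p^n, so the components G_j with p
    dividing j are exactly those that must vanish. *)
Lemma unit_supported_frob n F : (0 < n)%N ->
  unit_supported F <-> exists G : nat -> fps R,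
  (forall j m i, (j < p ^ n)%N -> mass m (G j) i = mass (m + n) F (j + p ^ n * i)) /\
  F = \sum_(j < p ^ n | ~~ (p %| j)%N) u ^+ j * frob (p ^ n) (G j).
Proof.
move=> n0; have pq : (p %| p ^ n)%N by rewrite dvdn_exp.
split=> [hF|[G [GP ->]]].
  have [G [GP FG]] := frob_decomposition n F; exists G; split=> //.
  rewrite {1}FG (bigID (fun j : 'I_(p ^ n) => (p %| j)%N)) /= big1 ?add0r // => j pj.
  have -> : G j = 0.
    apply: (mass_inj (n0 := 0)) => m i _; rewrite GP //.
    have -> : (m + n)%N = (m + n.-1).+1 by rewrite -addnS prednK.
    have /dvdnP[k ->] : (p %| j + p ^ n * i)%N by rewrite dvdn_add ?dvdn_mulr.
    by rewrite mulnC hF.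
  by rewrite subst0 ?mulr0 //; apply: top_nilp_upow.
apply: unit_supported_sum => j pj; apply: (unit_supported_large (n0 := n)) => k i nk.
rewrite -(subnK (leqW nk)) mass_frob //; case: eqP => [e|_]; last by rewrite mul0r.
by case/negP: pj; rewrite -e /dvdn modn_dvdm // modnMr.
Qed.

(** Multiplication by u^(p^n) translates a measure by p^n; this preserves the classes modulo p^n and
    the units, whence the direct implication. Conversely, vanishing masses mean that every G_j is
    divisible by pi, and phi^n(pi) = u^(p^n) - 1 factors out of the decomposition. *)
Lemma unit_supported_upow_sub1 n F : (0 < n)%N ->
  (exists2 H, unit_supported H & (u ^+ (p ^ n) - 1) * H = F) <->
  unit_supported F /\ forall j, mass n F j = 0.
Proof.
move=> n0; have pq : (p %| p ^ n)%N by rewrite dvdn_exp.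
split=> [[H hH <-]|[hF F0]].
  have e m x : mass m ((u ^+ (p ^ n) - 1) * H) (x + p ^ n) = mass m H x - mass m H (x + p ^ n).
    by rewrite mulrBl mul1r massB mass_shift.
  (* Adding p^m p^n to x keeps its class modulo p^m and writes it as a natural number of the form y
     + p^n, to which [e] applies. *)
  have e' m x : mass m ((u ^+ (p ^ n) - 1) * H) x =
                mass m ((u ^+ (p ^ n) - 1) * H) (x + (p ^ m).-1 * p ^ n + p ^ n).
    apply: mass_period; rewrite -addnA -mulSnr prednK ?pn_gt0 //.
    by rewrite -modnDmr modnMr addn0.
  split=> [m j|j]; rewrite e' e.
    have /dvdnP[k ->] : (p %| p * j + (p ^ m.+1).-1 * p ^ n)%N.
      by apply: dvdn_add; [apply: dvdn_mulr|apply: dvdn_mull].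
    have /dvdnP[l ->] : (p %| k * p + p ^ n)%N by rewrite dvdn_add ?dvdn_mull.
    by rewrite ![(_ * p)%N]mulnC !hH subrr.
  rewrite (@mass_period n H (_ + p ^ n) (j + (p ^ n).-1 * p ^ n)) ?subrr //.
  by rewrite -modnDmr modnn addn0.
have [G [GP FG]] := (unit_supported_frob F n0).1 hF.
pose G' j : fps R := Fps (fun k => G j k.+1).
(* The constant term of G_j is its total mass, that is, the mass of F on j + p^n Z_p. *)
have GG' (j : 'I_(p ^ n)) : G j = fpsX R * G' j.
  apply: fps_eqP => k; rewrite fps_coefXM; case: k => //.
  by rewrite -(mass0E _ 0) GP ?F0.
exists (\sum_(j < p ^ n | ~~ (p %| j)%N) u ^+ j * frob (p ^ n) (G' j)).
  apply: unit_supported_sum => j pj; apply: (unit_supported_large (n0 := n)) => k i nk.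
  rewrite -(subnK (leqW nk)) mass_frob //; case: eqP => [e|_]; last by rewrite mul0r.
  by case/negP: pj; rewrite -e /dvdn modn_dvdm // modnMr.
rewrite [RHS]FG mulr_sumr; apply: eq_bigr => j _.
have tn := top_nilp_upow (p ^ n).
by rewrite GG' substM // substX // mulrCA.
Qed.

(** * Powers u^a with a in Z_p *)

Section ZpPowers.
Variable a : Defs.Zp pr.
Definition zpow : fps R := fps_lim p (fun m => u ^+ approx a m).

Lemma approx_cong m k : (m <= k)%N -> approx a k = approx a m %[mod p ^ m.+1].
Proof.
by move=> /subnKC <-; rewrite approx_mod modn_small //; apply: Zmod_lt pr _ _.
Qed.

Lemma zpow_cvg : Jcvg p (fun m => u ^+ approx a m) zpow.
Proof.
apply: (Jcauchy_cvg hR) => N; exists N => k Nk.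
apply: inJ_le (inJ_upow_cong (approx_cong (leqnSn k))).
by rewrite leqW // leqW.
Qed.

Lemma zpow_approx m : inJ m.+2 (zpow - u ^+ approx a m).
Proof.
apply: (Jcvg_inJ (JcvgB zpow_cvg (Jcvg_cst p (u ^+ approx a m))) (K := m)) => k mk.
exact: inJ_upow_cong (approx_cong mk).
Qed.

Lemma top_nilp_zpow : top_nilp p (zpow - 1).
Proof.
apply: top_nilp_inJ1; have h := zpow_approx 0.
by apply: inJ_trans (inJ_le _ h) (inJ1_upow_sub1 _).
Qed.

Lemma mass_zpowX n i j :
  mass n.+1 (zpow ^+ i) j = (approx a n * i == j %[mod p ^ n.+1])%:R.
Proof.
apply: (padic_cvg_uniq hR (mass_lim n.+1 j (JcvgX i zpow_cvg))).
apply: (@padic_cvg_eventually _ _ _ _ n) => m nm.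
by rewrite -exprM mass_upow -modnMml (approx_cong nm) modnMml.
Qed.

Hypothesis a_unit : ~~ (p %| approx a 0)%N.

Lemma coprime_approx n m : coprime (approx a n) (p ^ m).
Proof.
apply: coprimeXr; rewrite coprime_sym prime_coprime //.
by rewrite /dvdn -[p in (_ %% p)%N]expn1 (approx_cong (leq0n n)) expn1.
Qed.

(** Substituting u^a for u is the push-forward along multiplication by a, which permutes the classes
    because a is a unit. *)
Lemma mass_zpow_subst n F j :
  mass n.+1 (fps_subst p F (zpow - 1)) (approx a n * j) = mass n.+1 F j.
Proof.
have tn := top_nilp_zpow.
apply: (mass_ext (cont_linear_subst tn)) => i.
rewrite substXn // subst_u // mass_zpowX mass_upow; congr (_ : bool)%:R.
wlog ij : i j / (i <= j)%N.
  move=> W; case: (leqP i j) => [|/ltnW] h; first exact: W.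
  by rewrite eq_sym [RHS]eq_sym; apply: W.
rewrite eq_sym [RHS]eq_sym !eqn_mod_dvd ?leq_mul2l ?ij ?orbT // -mulnBr.
by rewrite Gauss_dvdr // coprime_sym coprime_approx.
Qed.

Lemma unit_supported_subst F :
  unit_supported F -> unit_supported (fps_subst p F (zpow - 1)).
Proof.
move=> hF n j; set b := approx a n; set q := (p ^ n.+1)%N.
have co : coprime b q by apply: coprime_approx.
(* The Chinese remainder, 0 modulo b and 1 modulo q, equals k b; thus k is an inverse of b modulo
   q. *)
have /dvdnP[k ck] : (b %| chinese b q 0 1)%N.
  by rewrite /dvdn (chinese_modl co) mod0n.
rewrite -(hF n (k * j)%N) -[RHS]mass_zpow_subst; apply: mass_period.
have -> : (b * (p * (k * j)) = k * b * (p * j))%N by ring.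
by rewrite -ck -[RHS]modnMml (chinese_modr co) modnMml mul1n.
Qed.

End ZpPowers.

End Measures.

(** * p-adic completeness of the integers of E *)

Lemma fraction_denom (R : idomainType) (x : {fraction R}) :
  exists n d : R, d != 0 /\ FracField.tofrac d * x = FracField.tofrac n.
Proof.
elim/quotW: x => x; exists (frac x).1, (frac x).2; split; first exact: denom_ratioP.
apply/eqP; rewrite -[_ * _]/(FracField.mul _ _) !piE /FracField.mulf FracField.equivfE.
rewrite !numden_Ratio ?mulf_neq0 ?oner_eq0 ?denom_ratioP //.
by rewrite mulr1 mul1r.
Qed.

Definition infinitely_often (Q : nat -> Prop) : Prop :=
  forall K, exists2 k, (K <= k)%N & Q k.

Lemma infinite_pigeonhole (T : finType) (g : nat -> T) (Q : nat -> Prop) :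
  infinitely_often Q -> exists t, infinitely_often (fun k => Q k /\ g k = t).
Proof.
move=> hQ; apply: contrapT => none.
have bound t : exists K, forall k, (K <= k)%N -> Q k -> g k <> t.
  apply: contrapT => nb; apply: none; exists t => K.
  apply: contrapT => nK; apply: nb; exists K => k Kk Qk gk.
  by apply: nK; exists k.
pose B t := sval (cid (bound t)).
have [k hk Qk] := hQ (\max_t B t).
apply: (svalP (cid (bound (g k))) k _ Qk erefl).
by apply: leq_trans hk; apply: (leq_bigmax (g k)).
Qed.

(** * Divisibility and compactness in Z_p *)

Section PadicIntegers.
Variables (p : nat) (pr : prime p).
Local Notation ZZ := (Defs.Zp pr).

Lemma Zp_of_seq (f : nat -> nat) :
  (forall m, f m.+1 = f m %[mod p ^ m.+1]) ->
  exists x : ZZ, forall m, approx x m = (f m %% p ^ m.+1)%N.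
Proof.
move=> h.
have v m : ((f m)%:R : 'Z_(p ^ m.+1)) = (f m %% p ^ m.+1)%N :> nat.
  by rewrite val_Zp_nat // padic_mod_gt1.
have c m : transition (padic_system pr) m ((f m.+1)%:R : 'Z_(p ^ m.+2)) = (f m)%:R.
  apply: Zmod_eqP; rewrite [LHS](padic_trans_val pr) !v.
  by rewrite modn_dvdm ?dvdn_exp2l.
by exists (InvLim c) => m; apply: v.
Qed.

Lemma approx_lt (x : ZZ) n : (approx x n < p ^ n.+1)%N.
Proof. exact: (Zmod_lt pr). Qed.

Lemma approxD (x y : ZZ) n : approx (x + y) n = ((approx x n + approx y n) %% p ^ n.+1)%N.
Proof. exact: (Zmod_valD pr). Qed.

Lemma approx1 n : approx (1 : ZZ) n = 1%N.
Proof. by rewrite /approx /= modn_small // padic_mod_gt1. Qed.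

Lemma approx_nat k n : approx (k%:R : ZZ) n = (k %% p ^ n.+1)%N.
Proof.
elim: k => [|k IH]; first by rewrite mod0n.
by rewrite mulrS approxD IH approx1 modnDmr add1n.
Qed.

(** The class of x modulo p^(n+m+2), divided by p^(n+1), gives the class of the quotient modulo
    p^(m+1). *)
Lemma Zp_dvp (x : ZZ) n : approx x n = 0%N -> dvp p n.+1 x.
Proof.
move=> x0; have q0 : (0 < p ^ n.+1)%N by rewrite expn_gt0 prime_gt0.
have d m : (p ^ n.+1 %| approx x (n + m.+1))%N by rewrite /dvdn approx_mod x0.
have [|y hy] := @Zp_of_seq (fun m => approx x (n + m.+1) %/ p ^ n.+1)%N.
  move=> m; apply/eqP; rewrite -(eqn_pmul2r q0) !muln_modl -expnD !divnK //; apply/eqP.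
  have -> : (m.+1 + n.+1 = (n + m.+1).+1)%N by lia.
  have -> : (n + m.+2 = n + m.+1 + 1)%N by lia.
  by rewrite approx_mod modn_small // approx_lt.
exists y; apply: approx_inj => m; rewrite -natrX approxM approx_nat hy modnMm.
rewrite mulnC divnK // -(approx_mod x m n.+1).
by congr (approx _ _ %% _)%N; lia.
Qed.

Lemma Zp_congr_dvp (x y : ZZ) n : approx x n = approx y n -> dvp p n.+1 (x - y).
Proof.
move=> e; apply: Zp_dvp; have := approxD (x - y) y n; rewrite subrK e => h.
have : approx (x - y) n + approx y n == 0 + approx y n %[mod p ^ n.+1].
  by rewrite -h add0n modn_small // approx_lt.
by rewrite eqn_modDr mod0n modn_small ?approx_lt // => /eqP.
Qed.

Lemma Zp_sep (x : ZZ) : (forall n, dvp p n x) -> x = 0.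
Proof.
move=> h; apply: approx_inj => n; rewrite approx0; have [y ->] := h n.+1.
by rewrite -natrX approxM approx_nat modnn mul0n mod0n.
Qed.

Lemma Zp_dvp1 (x : ZZ) : dvp p 1 x -> approx x 0 = 0%N.
Proof. by move=> [y ->]; rewrite expr1 approxM approx_nat expn1 modnn mul0n mod0n. Qed.

(* Compactness of Z_p^d. *)
Lemma Zp_cluster d (y : nat -> 'I_d -> ZZ) : exists z : 'I_d -> ZZ,
  forall j, infinitely_often (fun k => forall i, approx (y k i) j = approx (z i) j).
Proof.
pose g j k : {ffun 'I_d -> 'Z_(p ^ j.+1)} := [ffun i => (y k i) j].
pose t j (Q : nat -> Prop) : {ffun 'I_d -> 'Z_(p ^ j.+1)} :=
  xget (g j 0%N) [set t | infinitely_often (fun k => Q k /\ g j k = t)]%classic.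
(* [Qs j] keeps the indices whose tuples have the chosen residues at all levels below j. Each choice
   retains infinitely many indices, so the default value in [t] is never taken. *)
pose Qs := fix Qs j : nat -> Prop :=
  if j is j'.+1 then fun k => Qs j' k /\ g j' k = t j' (Qs j') else fun=> True.
have inf j : infinitely_often (Qs j).
  elim: j => [|j IH] /=; first by move=> K; exists K.
  rewrite /t; case: xgetP => [_ -> //|none].
  by have [s hs] := infinite_pigeonhole (g j) IH; case: (none s).
have c i m : transition (padic_system pr) m (t m.+1 (Qs m.+1) i) = t m (Qs m) i.
  have [k _ /= [[_ <-] <-]] := inf m.+2 0%N.
  by rewrite !ffunE; apply: (componentP (y k i)).
exists (fun i => @InvLim (padic_system pr) (fun m => t m (Qs m) i) (c i)) => j K.
have [k Kk /= [_ e]] := inf j.+1 K; exists k => // i.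
by rewrite /approx /= -e ffunE.
Qed.

(** If p^(a+1) does not divide b, a Bezout relation solves b z = p^a modulo each large power of p.
    These solutions need not be compatible with each other; a cluster point solves the equation in
    Z_p. *)
Lemma Zp_div_pow (b : ZZ) : b != 0 -> exists r z, b * z = p%:R ^+ r.
Proof.
move=> /Zp_neq0P[a ha].
have b0 m : (a <= m)%N -> (0 < approx b m)%N.
  by move=> /subnKC <-; case: approx (ha (m - a)%N) => //; rewrite dvdn0.
have rl m : (a <= m)%N -> (gcdn (approx b m) (p ^ m.+1) %| p ^ a)%N.
  move=> am; have /(dvdn_pfactor _ _ pr)[e _ he] := dvdn_gcdr (approx b m) (p ^ m.+1).
  rewrite he dvdn_Pexp2l ?prime_gt1 //; rewrite leqNgt; apply/negP => ae.
  case/negP: (ha (m - a)%N); rewrite subnKC //.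
  by apply: dvdn_trans (dvdn_gcdl (approx b m) (p ^ m.+1)); rewrite he dvdn_exp2l.
have hz m : exists z : ZZ, (a <= m)%N -> approx (b * z) m = approx (p%:R ^+ a : ZZ) m.
  have [am|_] := leqP a m; last by exists 0.
  have /dvdnP[w hw] := rl m am.
  case: (egcdnP (p ^ m.+1) (b0 m am)) => km kn e _; exists (w * km)%:R => _.
  rewrite approxM approx_nat -natrX approx_nat modnMmr mulnCA [(_ * km)%N]mulnC e.
  by rewrite mulnDr hw mulnA modnMDl.
pose zs m (_ : 'I_1) := sval (cid (hz m)).
have [z hz'] := Zp_cluster zs.
exists a, (z ord0).
apply/eqP; rewrite -subr_eq0; apply/eqP; apply: Zp_sep => n.
apply: (dvp_le (leqnSn n)); apply: Zp_congr_dvp.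
have [k] := hz' n (maxn a n); rewrite geq_max => /andP[ak nk] /(_ ord0) e.
have := svalP (cid (hz k)) ak => h.
rewrite approxM -e -approxM.
have key (x : ZZ) : approx x n = (approx x k %% p ^ n.+1)%N.
  by rewrite -(subnKC nk) approx_mod.
by rewrite [LHS]key [RHS]key h.
Qed.

End PadicIntegers.

(** * Integral elements and lattices *)

Lemma integral_scaled_root (Z : comNzRingType) (L : fieldType) (f : {rmorphism Z -> L})
    (q r m : nat) (c : 'I_m -> Z) (s : 'I_m -> L) (x : L) :
  (forall i, f (c i) = q%:R ^+ r * s i) -> x ^+ m + \sum_(i < m) s i * x ^+ i = 0 ->
  integralOver f (q%:R ^+ r * x).
Proof.
move=> fc e.
pose a i : Z := if insub i is Some j then q%:R ^+ (r * (m - i).-1) * c j else 0.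
pose Q : {poly Z} := 'X^m + \poly_(i < m) a i.
exists Q; first by rewrite monicE lead_coefDl ?lead_coefXn // size_polyXn ltnS size_poly.
apply/rootP.
have -> : map_poly f Q = 'X^m + \poly_(i < m) f (a i).
  rewrite rmorphD /= map_polyXn; congr (_ + _); apply/polyP => i.
  by rewrite coef_map !coef_poly; case: ltnP => // _; exact: rmorph0.
rewrite hornerD hornerXn horner_poly.
transitivity (q%:R ^+ (r * m) * (x ^+ m + \sum_(i < m) s i * x ^+ i)); last by rewrite e mulr0.
rewrite mulrDr; congr (_ + _).
  by rewrite exprMn -exprM.
rewrite mulr_sumr; apply: eq_bigr => i _; rewrite /a valK.
rewrite rmorphM rmorphXn rmorph_nat fc exprMn.
have -> : (r * m = r * (m - i).-1 + r + r * i)%N by have := ltn_ord i; nia.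
by rewrite !exprD -exprM; ring.
Qed.

(** Multiplied by q^m, a monic equation of degree m for z = 1/q becomes 1 + q c = 0 with c in Z.
    Hence p is not invertible in the integral closure, as it is not in Z_p. *)
Lemma integral_inv_nat (Z : comNzRingType) (L : fieldType) (f : {rmorphism Z -> L})
    (q : nat) (z : L) :
  injective f -> integralOver f z -> q%:R * z = 1 -> exists w : Z, q%:R * w = 1.
Proof.
move=> f_inj [Q Qm /rootP Qz] qz.
have [m sQ] : exists m, size Q = m.+1.
  by exists (size Q).-1; rewrite prednK // size_poly_gt0 monic_neq0.
exists (- \sum_(i < m) Q`_i * q%:R ^+ (m - i).-1); apply: f_inj.
rewrite rmorphM rmorph_nat rmorphN rmorph_sum rmorph1 mulrN mulr_sumr.
apply/eqP; rewrite eq_sym -subr_eq0 opprK; apply/eqP.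
transitivity (q%:R ^+ m * (map_poly f Q).[z]); last by rewrite Qz mulr0.
rewrite (horner_coef_wide _ (n := m.+1)); last first.
  by rewrite -sQ size_poly.
rewrite big_ord_recr /= [LHS]addrC mulrDr; congr (_ + _).
  rewrite mulr_sumr; apply: eq_bigr => i _; rewrite rmorphM rmorphXn rmorph_nat.
  have -> : (q%:R : L) ^+ m = q%:R ^+ (m - i).-1 * q%:R * q%:R ^+ i.
    by rewrite -exprSr -exprD; congr (_ ^+ _); have := ltn_ord i; lia.
  have qzi : q%:R ^+ i * z ^+ i = 1 by rewrite -exprMn qz expr1n.
  rewrite coef_map /=.
  transitivity (q%:R * (f Q`_i * q%:R ^+ (m - i).-1) * (q%:R ^+ i * z ^+ i)); last by ring.
  by rewrite qzi mulr1.
have -> : (map_poly f Q)`_m = 1.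
  by rewrite coef_map; move/monicP: Qm; rewrite lead_coefE sQ /= => ->; rewrite rmorph1.
by rewrite mul1r -exprMn qz expr1n.
Qed.

Section Lattice.
Variables (Z : comNzRingType) (F : fieldType) (E : fieldExtType F).
Variables (j : Z -> F) (f : {rmorphism Z -> E}) (q : nat).
Hypotheses (fE : forall c, f c = (j c)%:A) (f_inj : injective f).
Hypothesis (q0 : q%:R != 0 :> F).
Hypothesis denom : forall (I : finType) (x : I -> F),
  exists r (c : I -> Z), forall i, q%:R ^+ r * x i = j (c i).

Lemma natrX_alg r (x : F) : (q%:R ^+ r * x)%:A = q%:R ^+ r * x%:A :> E.
Proof. by rewrite -[LHS]/(in_alg E _) rmorphM rmorphXn rmorph_nat. Qed.

Lemma integral_natX_mul (x : E) : exists r, integralOver f (q%:R ^+ r * x).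
Proof.
have /polyOver1P[g hg] := minPolyOver 1%AS x.
have gm : g \is monic by rewrite -(map_monic (in_alg E)) -hg monic_minPoly.
have gx : (map_poly (in_alg E) g).[x] = 0 by rewrite -hg minPolyxx.
have [m sg] : exists m, size g = m.+1.
  by exists (size g).-1; rewrite prednK // size_poly_gt0 monic_neq0.
have [r [c hc]] := denom (fun i : 'I_m => g`_i).
exists r.
apply: (@integral_scaled_root _ _ f q r m c (fun i => (g`_i)%:A)) => [i|].
  by rewrite fE -hc natrX_alg.
transitivity (map_poly (in_alg E) g).[x]; last exact: gx.
rewrite horner_coef size_map_poly sg big_ord_recr /= [LHS]addrC; congr (_ + _).
  by apply: eq_bigr => i _; rewrite coef_map.
have g1 : g`_m = 1 by move/monicP: gm; rewrite lead_coefE sg.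
by rewrite coef_map g1 /= scale1r mul1r.
Qed.

(** A basis of E over F, each vector being scaled by a power of q that makes it integral; the
    coordinates of any x have a power of q as common denominator. *)
Lemma integral_lattice : exists d (b : 'I_d -> E),
  [/\ forall i, integralOver f (b i),
      forall x, exists r c, q%:R ^+ r * x = \sum_i f (c i) * b i
    & forall c : 'I_d -> Z, \sum_i f (c i) * b i = 0 -> forall i, c i = 0].
Proof.
pose d := \dim {:E}; pose B := vbasis {:E}.
have h i := cid (integral_natX_mul (B`_i)).
pose s := fun i : nat => sval (h i).
pose b (i : 'I_d) := q%:R ^+ s i * B`_i.
have bi i : integralOver f (b i) by apply: (svalP (h i)).
have bE i : b i = (q%:R ^+ s i) *: B`_i.
  by rewrite -mulr_algl -[q%:R ^+ s i]mulr1 natrX_alg scale1r mulr1.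
exists d, b; split=> // [x|c c0 i].
  have [r [c hc]] := denom (fun i : 'I_d => coord B i x / q%:R ^+ s i).
  exists r, c; rewrite [X in _ * X](coord_vbasis (memvf x)) mulr_sumr.
  apply: eq_bigr => i _; rewrite fE -hc natrX_alg bE -mulrA mulr_algl scalerA.
  by rewrite divfK // expf_neq0.
have /freeP/(_ (fun i => j (c i) * q%:R ^+ s i)) fB := basis_free (vbasisP {:E}).
have {}fB := fB _ i.
apply: f_inj; rewrite fE rmorph0.
have /eqP : j (c i) * q%:R ^+ s i = 0.
  apply: fB; apply: etrans c0; apply: eq_bigr => k _.
  by rewrite fE mulr_algl bE scalerA.
rewrite mulf_eq0 (negbTE (expf_neq0 _ q0)) orbF => /eqP ->.
exact: scale0r.
Qed.

End Lattice.

(** * Completeness of the integral closure *)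

Section Completeness.
Variables (p : nat) (pr : prime p) (E : fieldType).
Local Notation ZZ := (Defs.Zp pr).
Variable f : {rmorphism ZZ -> E}.
Hypothesis f_inj : injective f.
Local Notation int := (integralOver f).
Hypothesis integral_multiple : forall x, exists r, int (p%:R ^+ r * x).

Lemma Zp_nat_neq0 : p%:R != 0 :> ZZ.
Proof.
apply/eqP => /(congr1 (fun x : ZZ => approx x 1)).
rewrite approx_nat approx0 modn_small; first by case: p pr.
by rewrite -{1}(expn1 p) ltn_exp2l ?prime_gt1.
Qed.

Lemma p_neq0 : p%:R != 0 :> E.
Proof.
by rewrite -(rmorph_nat f p) -(rmorph0 f) (inj_eq f_inj) Zp_nat_neq0.
Qed.

Lemma pX_neq0 k : p%:R ^+ k != 0 :> E.
Proof. by rewrite expf_neq0 ?p_neq0. Qed.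

Lemma integral_sum (I : Type) (r : seq I) (P : pred I) (g : I -> E) :
  (forall i, P i -> int (g i)) -> int (\sum_(i <- r | P i) g i).
Proof.
by move=> h; apply: big_ind => //; [exact: integral0|exact: integral_add].
Qed.

Lemma integral_p_inv (z : E) : int z -> p%:R * z <> 1.
Proof.
move=> zi /(integral_inv_nat f_inj zi)[w hw].
have := Zp_dvp1 (ex_intro _ w (esym hw) : dvp p 1 _).
by rewrite approx1.
Qed.

(** If y were nonzero, p^r / y would be integral for some r; multiplied by z = y / p^(r+1), it would
    make 1/p integral. *)
Lemma integral_divisible (y : E) :
  (forall k, exists2 z, int z & y = p%:R ^+ k * z) -> y = 0.
Proof.
move=> h; apply/eqP/negPn/negP => y0; have [r hr] := integral_multiple y^-1.
have [z zi yz] := h r.+1.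
apply: (integral_p_inv (integral_mul hr zi)).
transitivity (y^-1 * y); last exact: mulVf.
rewrite {3}yz exprS; ring.
Qed.

Variables (d : nat) (b : 'I_d -> E).
Hypothesis b_int : forall i, int (b i).
Hypothesis b_span : forall x, exists r c, p%:R ^+ r * x = \sum_i f (c i) * b i.
Hypothesis b_free : forall c : 'I_d -> ZZ, \sum_i f (c i) * b i = 0 -> forall i, c i = 0.
Local Notation lin c := (\sum_i f (c i) * b i).

Lemma lin_int c : int (lin c).
Proof.
by apply: integral_sum => i _; apply: integral_mul => //; apply: integral_id.
Qed.

Lemma lin_congr c c' j : (forall i, approx (c i) j = approx (c' i) j) ->
  exists2 z, int z & lin c - lin c' = p%:R ^+ j.+1 * z.
Proof.
move=> e; have h i := cid (Zp_congr_dvp (e i)).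
exists (lin (fun i => sval (h i))); first exact: lin_int.
rewrite -sumrB mulr_sumr; apply: eq_bigr => i _.
rewrite -mulrBl -rmorphB {1}(svalP (h i)) rmorphM rmorphXn rmorph_nat.
by rewrite mulrA.
Qed.

(* Otherwise some vectors of the lattice outside of p times the lattice would
   be divisible by arbitrary powers of p in the integral closure; a cluster
   point of these vectors would be nonzero and infinitely divisible by p. *)
Lemma integral_bounded : exists r, forall x, int x -> exists c, p%:R ^+ r * x = lin c.
Proof.
apply: contrapT => unbounded.
have hk k : exists c : 'I_d -> ZZ,
    (exists2 x, int x & lin c = p%:R ^+ k * x) /\ exists i, approx (c i) 0 <> 0%N.
  apply: contrapT => none; apply: unbounded; exists k => x xi.
  (* Let a be least with p^a x in the lattice. If a > k, then p^a x is divisible by p^k in the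
     integral closure, and minimality keeps it outside p times the lattice. *)
  pose P a := `[< exists c, p%:R ^+ a * x = lin c >].
  have exP : exists a, P a.
    by have [r [c hc]] := b_span x; exists r; apply/asboolP; exists c.
  case: (ex_minnP exP) => a /asboolP[c hc] amin.
  have up : forall s, (a <= s)%N -> exists c, p%:R ^+ s * x = lin c.
    move=> s /subnK <-; exists (fun i => p%:R ^+ (s - a) * c i).
    rewrite exprD -mulrA hc mulr_sumr; apply: eq_bigr => i _.
    by rewrite rmorphM rmorphXn rmorph_nat mulrA.
  apply: up; rewrite leqNgt; apply/negP => ka; apply: none; exists c; split.
    exists (p%:R ^+ (a - k) * x); last by rewrite -hc mulrA -exprD subnKC // ltnW.
    by apply: integral_mul => //; rewrite -natrX; apply: integral_nat.
  apply: contrapT => c0; case: a hc amin ka => // a hc amin ka.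
  have h i : exists w, c i = p%:R * w.
    have : approx (c i) 0 = 0%N by apply: contrapT => ci; apply: c0; exists i.
    by move/Zp_dvp.
  suff : P a by move/amin; rewrite ltnn.
  apply/asboolP; exists (fun i => sval (cid (h i))); apply: (mulfI p_neq0).
  rewrite mulrA -exprS hc mulr_sumr; apply: eq_bigr => i _.
  by rewrite {1}(svalP (cid (h i))) rmorphM rmorph_nat mulrA.
pose c k := sval (cid (hk k)).
have [z hz] := Zp_cluster c.
have y0 : lin z = 0.
  apply: integral_divisible => j.
  have [k jk e] := hz j j.
  have [w wi hw] := lin_congr e.
  have [[x xi hx] _] := svalP (cid (hk k)); rewrite -/(c k) in hx.
  exists (p%:R ^+ (k - j) * x - p%:R * w).
    by apply: integral_sub; apply: integral_mul => //; rewrite -?natrX; apply: integral_nat.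
  rewrite mulrBr !mulrA -exprD subnKC // -hx -exprSr -hw; ring.
have [k _ e] := hz 0%N 0%N.
have [_ [i ci]] := svalP (cid (hk k)); apply: ci; rewrite -/(c k) e.
by rewrite b_free // approx0.
Qed.

(** Multiplication by p^r sends the sequence into a lattice isomorphic to Z_p^d, where it has a
    cluster point; the Cauchy condition turns this into a limit once p^r is divided out. *)
Lemma integral_complete (u : nat -> E) : (forall k, int (u k)) ->
  (forall N, exists K, forall k, (K <= k)%N ->
     exists2 z, int z & u k.+1 - u k = p%:R ^+ N * z) ->
  exists2 l, int l & forall N, exists K, forall k, (K <= k)%N ->
     exists2 z, int z & u k - l = p%:R ^+ N * z.
Proof.
move=> ui cauchy; have [r hr] := integral_bounded.
have h k := cid (hr (u k) (ui k)); pose c k := sval (h k).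
have hc k : p%:R ^+ r * u k = lin (c k) by apply: (svalP (h k)).
have [z hz] := Zp_cluster c.
have near N : forall K, exists2 k, (K <= k)%N &
    exists2 w, int w & lin z - p%:R ^+ r * u k = p%:R ^+ N * w.
  move=> K; have [k Kk e] := hz N K; exists k => //.
  have [w wi hw] := @lin_congr z (c k) N (fun i => esym (e i)).
  exists (p%:R * w); first by apply: integral_mul => //; apply: integral_nat.
  by rewrite hc hw mulrA -exprSr.
(* Precision p^r suffices to show that the cluster point is p^r times an integral element, namely
   u_(k0) + w0. *)
have [k0 _ [w0 wi0 hw0]] := near r 0%N.
exists (u k0 + w0); first exact: integral_add.
have lE : p%:R ^+ r * (u k0 + w0) = lin z by rewrite mulrDr -hw0; ring.
move=> N; have [K hK] := cauchy N; exists K => k Kk.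
have [k1 kk1 [w wi hw]] := near (r + N)%N k.
have e1 : u k0 + w0 - u k1 = p%:R ^+ N * w.
  by apply: (mulfI (pX_neq0 r)); rewrite mulrBr lE hw exprD mulrA.
have [v vi hv] : exists2 v, int v & u k1 - u k = p%:R ^+ N * v.
  rewrite -(subnKC kk1); elim: (k1 - k)%N => [|t [v vi IH]].
    by exists 0; [exact: integral0 | rewrite addn0 subrr mulr0].
  have [v' vi' hv'] := hK (k + t)%N (leq_trans Kk (leq_addr _ _)).
  exists (v' + v); first exact: integral_add.
  by rewrite mulrDr -IH -hv' addnS; ring.
exists (- v - w); first by apply: integral_sub => //; apply: integral_opp.
by rewrite mulrBr mulrN -hv -e1; ring.
Qed.

End Completeness.

Section Integers.
Variables (p : nat) (pr : prime p).
Local Notation ZZ := (Defs.Zp pr).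

Lemma Qp_denom (x : Qp pr) : exists r (c : ZZ), p%:R ^+ r * x = FracField.tofrac c.
Proof.
have [n [d [d0 dx]]] := fraction_denom x; have [r [z hz]] := Zp_div_pow d0.
exists r, (z * n); rewrite tofracM -dx mulrA -tofracM.
by rewrite [z * d]mulrC hz tofracXn rmorph_nat.
Qed.

Lemma Qp_denom_seq (I : finType) (x : I -> Qp pr) :
  exists r (c : I -> ZZ), forall i, p%:R ^+ r * x i = FracField.tofrac (c i).
Proof.
have h i := cid (Qp_denom (x i)).
pose r := \max_i sval (h i); exists r.
have h' i : exists c : ZZ, p%:R ^+ r * x i = FracField.tofrac c.
  have [c hc] := svalP (h i); exists (p%:R ^+ (r - sval (h i)) * c).
  rewrite tofracM tofracXn rmorph_nat -hc mulrA -exprD subnK //.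
  exact: (leq_bigmax i).
by exists (fun i => sval (cid (h' i))) => i; apply: (svalP (cid (h' i))).
Qed.

Variable E : fieldExtType (Qp pr).

Lemma Zp_to_inj : injective (Zp_to E).
Proof.
move=> a b /(fmorph_inj (in_alg E)) /eqP.
by rewrite tofrac_eq => /eqP.
Qed.

Lemma integers_dvp N (x : integers E) :
  dvp p N x <-> exists2 z, integralOver (Zp_to E) z & integer_val x = p%:R ^+ N * z.
Proof.
split=> [[y ->]|[z zi xz]].
  exists (integer_val y); first exact/asboolP/integerP.
  by rewrite -[LHS]/(val _) rmorphM rmorphXn rmorph_nat.
have zi' : z \in @is_integer p pr E by apply/asboolP.
exists (Integer zi'); apply: val_inj.
by rewrite rmorphM rmorphXn rmorph_nat.
Qed.

Lemma Zp_toE (c : ZZ) : Zp_to E c = (FracField.tofrac c)%:A.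
Proof. by []. Qed.

Lemma padic_integers : padic_ring p (integers E).
Proof.
have inj := Zp_to_inj.
have mult : forall x : E, exists r, integralOver (Zp_to E) (p%:R ^+ r * x).
  exact: (@integral_natX_mul _ _ E _ (Zp_to E) p Zp_toE Qp_denom_seq).
have pF : p%:R != 0 :> Qp pr.
  by rewrite -(rmorph_nat (@FracField.tofrac _)) tofrac_eq0 Zp_nat_neq0.
have [d [b [b_int b_span b_free]]] := integral_lattice Zp_toE inj pF Qp_denom_seq.
have valB (x y : integers E) : integer_val (x - y) = integer_val x - integer_val y.
  exact: (rmorphB (val : {rmorphism integers E -> E})).
split=> [x|x h|u cauchy].
- move/(congr1 val); rewrite rmorphM rmorph_nat rmorph0 => /eqP.
  rewrite mulf_eq0 (negbTE (p_neq0 inj)) => /eqP x0; apply: val_inj; rewrite rmorph0.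
  exact: x0.
- apply: val_inj; rewrite rmorph0; apply: (integral_divisible inj mult) => k.
  exact/integers_dvp/h.
have ui k : integralOver (Zp_to E) (integer_val (u k)) by apply/asboolP/integerP.
have [|l li hl] := integral_complete inj mult b_int b_span b_free ui.
  move=> N; have [K hK] := cauchy N; exists K => k /hK /integers_dvp.
  by rewrite valB.
have li' : l \in @is_integer p pr E by apply/asboolP.
exists (Integer li') => N; have [K hK] := hl N; exists K => k /hK h.
by apply/integers_dvp; rewrite valB.
Qed.

End Integers.

(** * The operator psi *)

Lemma irreducible_factor (F : fieldType) (P : {poly F}) : (1 < size P)%N ->
  exists2 Q, irreducible_poly Q & Q %| P.
Proof.
have [n] := ubnP (size P); elim: n P => // n IH P Pn P1.
have [irr|/not_andP[]] := pselect (irreducible_poly P); first by exists P.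
  by rewrite P1.
move=> /existsNP[q /not_implyP[q1 /not_implyP[qP nqP]]].
have P0 : P != 0 by rewrite -size_poly_gt0 ltnW.
have q0 : q != 0 by apply: contraTneq qP => ->; rewrite dvd0p.
have ltq : (size q < size P)%N.
  by rewrite ltn_neqAle dvdp_leq // andbT dvdp_size_eqp //; apply/negP.
have [||Q irrQ Qq] := IH q.
- by apply: leq_trans ltq _; rewrite -ltnS.
- by rewrite ltn_neqAle eq_sym q1 size_poly_gt0.
by exists Q => //; apply: dvdp_trans qP.
Qed.

Section BaseFieldAlg.
Variables (F0 : fieldType) (F : fieldExtType F0) (L : fieldExtType F).

(** Adjoining a root to F gives an extension of F, whereas [is_psi] asks for an extension of Q_p and
    a Q_p-linear embedding; this is the embedding after restriction of scalars. *)
Definition base_in_alg (x : F) : baseFieldType L := in_alg L x.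

Fact base_in_alg_additive : zmod_morphism base_in_alg.
Proof. exact: (rmorphB (in_alg L)). Qed.
Fact base_in_alg_multiplicative : monoid_morphism base_in_alg.
Proof. by split; [exact: (rmorph1 (in_alg L))|exact: (rmorphM (in_alg L))]. Qed.
Fact base_in_alg_scalable : scalable base_in_alg.
Proof.
move=> a x; rewrite baseField_scaleE.
have -> : base_in_alg (a *: x) = (a%:A * x) *: (1 : L) by rewrite mulr_algl.
by rewrite -scalerA.
Qed.
HB.instance Definition _ := GRing.isZmodMorphism.Build F (baseFieldType L)
  base_in_alg base_in_alg_additive.
HB.instance Definition _ := GRing.isMonoidMorphism.Build F (baseFieldType L)
  base_in_alg base_in_alg_multiplicative.
HB.instance Definition _ := GRing.isScalable.Build F0 F (baseFieldType L) _
  base_in_alg base_in_alg_scalable.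

End BaseFieldAlg.

(** A root z of an irreducible factor of 1 + X + ... + X^(p-1) satisfies z^p = 1, and z is not 1
    because the value of this polynomial at 1 is p. *)
Lemma adjoin_root_unity (F0 : fieldType) (F : fieldExtType F0) (p : nat) :
  prime p -> p%:R != 0 :> F ->
  exists (L : fieldExtType F0) (iota : {lrmorphism F -> L}) (z : L),
    p.-primitive_root z.
Proof.
move=> pr pF; pose P : {poly F} := \poly_(i < p) 1.
have sP : size P = p by rewrite size_poly_eq ?oner_neq0.
have [|Q irrQ /dvdpP[S PE]] := @irreducible_factor _ P; first by rewrite sP prime_gt1.
have [L _ [z Qz _]] := irredp_FAdjoin irrQ.
have zsum : \sum_(i < p) z ^+ i = 0.
  have : (map_poly (in_alg L) P).[z] = 0.
    by rewrite PE rmorphM hornerM (rootP Qz) mulr0.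
  rewrite horner_coef size_map_poly sP => e; apply: etrans e.
  by apply: eq_bigr => i _; rewrite coef_map coef_poly ltn_ord /= scale1r mul1r.
have zp : z ^+ p = 1 by apply/eqP; rewrite -subr_eq0 subrX1 zsum mulr0.
exists (baseFieldType L), (@base_in_alg F0 F L), z.
have [m zm mp] := prim_order_exists (prime_gt0 pr) zp.
have [m1|m1] := eqVneq m 1%N; last by rewrite -(prime_nt_dvdP pr m1 mp).
have z1 : z = 1 by rewrite -[z]expr1 -m1 (prim_expr_order zm).
case/eqP: pF; apply: (fmorph_inj (in_alg L)); rewrite rmorph0 rmorph_nat; apply: etrans zsum.
rewrite z1 (eq_bigr (fun=> 1)) ?sumr_const ?card_ord // => i _; exact: expr1n.
Qed.

(** For 0 < i < p, multiplication by a root w other than 1 permutes the roots, so the sum is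
    multiplied by w^i, which is not 1. *)
Lemma sum_roots_unity (L : fieldType) (p i : nat) (ws : seq L) :
  prime p -> p%:R != 0 :> L -> \prod_(w <- ws) ('X - w%:P) = 'X^p - 1 -> (i < p)%N ->
  \sum_(w <- ws) w ^+ i = (i == 0%N)%:R * p%:R.
Proof.
move=> pr p0 prodE ip.
have sws : size ws = p.
  have := congr1 (fun P : {poly L} => size P) prodE.
  by rewrite size_prod_XsubC size_XnsubC ?prime_gt0 // => -[].
have uws : uniq ws by rewrite -separable_prod_XsubC prodE separable_Xn_sub_1.
have memE w : (w \in ws) = (w ^+ p == 1).
  by rewrite -root_prod_XsubC prodE rootE !hornerE subr_eq0.
have [->|i0] := eqVneq i 0%N.
  by rewrite mul1r big_const_seq count_predT iter_addr_0 sws.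
rewrite mul0r.
have [w wws w1] : exists2 w, w \in ws & w != 1.
  apply/hasP; apply: contraT => /hasPn all1.
  have : (size ws <= size [:: 1%R : L])%N.
    by apply: uniq_leq_size => // x /all1; rewrite negbK inE.
  by rewrite sws leqNgt prime_gt1.
have wp : w ^+ p = 1 by apply/eqP; rewrite -memE.
have prim : p.-primitive_root w.
  have [m wm mp] := prim_order_exists (prime_gt0 pr) wp.
  have [m1|m1] := eqVneq m 1%N; last by rewrite -(prime_nt_dvdP pr m1 mp).
  by case/eqP: w1; rewrite -[w]expr1 -m1 (prim_expr_order wm).
have w0 : w != 0.
  apply: contra_eq_neq wp => ->.
  by rewrite expr0n gtn_eqF ?prime_gt0 // eq_sym oner_eq0.
have mul_perm : perm_eq [seq w * x | x <- ws] ws.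
  have umul : uniq [seq w * x | x <- ws] by rewrite map_inj_uniq //; apply: mulfI.
  apply: uniq_perm => //; apply: (uniq_min_size umul _ _).2; last by rewrite size_map.
  by move=> _ /mapP[x xws ->]; rewrite memE exprMn wp mul1r -memE.
have e : \sum_(x <- ws) x ^+ i = w ^+ i * \sum_(x <- ws) x ^+ i.
  rewrite -{1}(perm_big _ mul_perm) big_map mulr_sumr.
  by apply: eq_bigr => x _; rewrite exprMn.
have wi : 1 - w ^+ i != 0.
  rewrite subr_eq0 eq_sym -(prim_order_dvd prim) gtnNdvd // lt0n.
  exact: i0.
by apply: (mulfI wi); rewrite mulr0 mulrBl mul1r -e subrr.
Qed.

(** * Change of coefficient ring *)

Section FpsMap.
Variables (p : nat) (R S : comNzRingType) (f : {rmorphism R -> S}).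
Implicit Types F G Q : fps R.

Lemma fps_mapC a : fps_map f (fpsC a) = fpsC (f a).
Proof. by apply: fps_eqP => -[|m] //=; rewrite rmorph0. Qed.

Lemma fps_mapX : fps_map f (fpsX R) = fpsX S.
Proof. by apply: fps_eqP => m; rewrite /= rmorph_nat. Qed.

Fact fps_map_additive : zmod_morphism (fps_map f).
Proof. by move=> F G; apply: fps_eqP => m; rewrite /= rmorphB. Qed.
Fact fps_map_multiplicative : monoid_morphism (fps_map f).
Proof.
split; first by rewrite -[1]/(fpsC 1) fps_mapC rmorph1.
move=> F G; apply: fps_eqP => m; rewrite /= rmorph_sum.
by apply: eq_bigr => i _; rewrite rmorphM.
Qed.
HB.instance Definition _ := GRing.isZmodMorphism.Build (fps R) (fps S)
  (fps_map f) fps_map_additive.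
HB.instance Definition _ := GRing.isMonoidMorphism.Build (fps R) (fps S)
  (fps_map f) fps_map_multiplicative.

Lemma inJ_map N F : inJ p N F -> inJ p N (fps_map f F).
Proof.
by move=> h m; have [y hy] := h m; exists (f y); rewrite /= hy rmorphM rmorphXn rmorph_nat.
Qed.

Lemma top_nilp_map Q : top_nilp p Q -> top_nilp p (fps_map f Q).
Proof.
by move=> h N; have [K hK] := h N; exists K => k /hK /inJ_map; rewrite rmorphXn.
Qed.

Lemma fps_map_inj : injective f -> injective (fps_map f).
Proof.
move=> inj F G e; apply: fps_eqP => m; apply: inj.
exact: (congr1 (fun H : fps S => H m) e).
Qed.

Hypotheses (hR : padic_ring p R) (hS : padic_ring p S).

Lemma fps_map_subst F Q : top_nilp p Q ->
  fps_map f (fps_subst p F Q) = fps_subst p (fps_map f F) (fps_map f Q).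
Proof.
move=> tQ; have tQ' := top_nilp_map tQ.
apply: (Jcvg_uniq hS _ (subst_cvg hS _ tQ')) => N.
have [K hK] := subst_cvg hR F tQ N; exists K => k /hK /inJ_map.
rewrite rmorphB rmorph_sum; congr (inJ _ _ (_ - _)); apply: eq_bigr => i _.
by rewrite rmorphM rmorphXn /= fps_mapC.
Qed.

End FpsMap.

(** * Averaging over p-th roots of unity *)

Section Average.
Variables (p : nat) (R : comNzRingType).
Hypotheses (pr : prime p) (p_odd : odd p) (hR : padic_ring p R).
Local Notation u := (1 + fpsX R).

Lemma inJ_natl F : inJ p 1 (p%:R * F : fps R).
Proof. by apply: inJ_mulr; rewrite -fpsC_nat; apply/inJC; apply: dvp_p. Qed.

(** Modulo p, the p-th power of z u - 1 is z^p u^p - 1 = u^p - 1, which lies in (p, pi). *)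
Lemma top_nilp_unity (z : R) : z ^+ p = 1 -> top_nilp p (fpsC z * u - 1).
Proof.
move=> zp; have [h] := prime_exprX 1 (fpsC z * u) pr p_odd; rewrite expn1 => e.
apply: (@top_nilpP _ _ _ p.-1); rewrite prednK ?prime_gt0 // e exprMn -rmorphXn zp rmorph1 mul1r.
by apply: inJD; [exact: inJ1_upow_sub1|exact: inJ_natl].
Qed.

(* u^p is invariant under u |-> z u, hence so are the series in u^p - 1. *)
Lemma unity_average (zs : seq R) (G : nat -> fps R) :
  (forall z, z \in zs -> z ^+ p = 1) ->
  (forall i, (i < p)%N -> \sum_(z <- zs) z ^+ i = (i == 0%N)%:R * p%:R) ->
  \sum_(z <- zs) fps_subst p (\sum_(j < p) u ^+ j * fps_subst p (G j) (u ^+ p - 1))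
                           (fpsC z * u - 1)
  = p%:R * fps_subst p (G 0%N) (u ^+ p - 1).
Proof.
move=> zsp zsum; have tu := @top_nilp_upow p R p.
transitivity (\sum_(z <- zs) \sum_(j < p)
    fpsC (z ^+ j) * (u ^+ j * fps_subst p (G j) (u ^+ p - 1))).
  apply: eq_big_seq => z zzs; have tz := top_nilp_unity (zsp z zzs).
  have zE : fps_subst p u (fpsC z * u - 1) = fpsC z * u by apply: subst_u.
  rewrite subst_sum //; apply: eq_bigr => j _.
  have PE : fps_subst p (u ^+ p - 1) (fpsC z * u - 1) = u ^+ p - 1.
    by rewrite substB // subst1 // substXn // zE exprMn -rmorphXn zsp // rmorph1 mul1r.
  rewrite substM // substXn // zE subst_comp ?PE //.
  by rewrite exprMn -rmorphXn mulrA.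
rewrite exchange_big /=.
have sumE j : (j < p)%N ->
    \sum_(z <- zs) fpsC (z ^+ j) * (u ^+ j * fps_subst p (G j) (u ^+ p - 1)) =
    (j == 0%N)%:R * (p%:R * (u ^+ j * fps_subst p (G j) (u ^+ p - 1))).
  by move=> jp; rewrite -mulr_suml -rmorph_sum zsum // rmorphM !rmorph_nat !mulrA.
rewrite (eq_bigr _ (fun j _ => sumE _ (ltn_ord j))).
have p0 := prime_gt0 pr; rewrite (bigD1 (Ordinal p0)) //= big1 => [|j j0].
  by rewrite addr0 !mul1r.
by rewrite [_ == 0%N](negbTE j0) mul0r.
Qed.

End Average.

Section IntegersMap.
Variables (p : nat) (pr : prime p) (E L : fieldExtType (Qp pr)).
Variable f : {lrmorphism E -> L}.

Lemma integer_valB (K : fieldExtType (Qp pr)) (x y : integers K) :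
  integer_val (x - y) = integer_val x - integer_val y.
Proof. exact: (rmorphB (val : {rmorphism integers K -> K})). Qed.

Lemma integer_valM (K : fieldExtType (Qp pr)) (x y : integers K) :
  integer_val (x * y) = integer_val x * integer_val y.
Proof. exact: (rmorphM (val : {rmorphism integers K -> K})). Qed.

Lemma integer_val1 (K : fieldExtType (Qp pr)) : integer_val (1 : integers K) = 1.
Proof. exact: (rmorph1 (val : {rmorphism integers K -> K})). Qed.

Fact integers_map_additive : zmod_morphism (integers_map f).
Proof.
move=> x y; apply: val_inj; rewrite [RHS]integer_valB.
by rewrite -(rmorphB f) -integer_valB.
Qed.
Fact integers_map_multiplicative : monoid_morphism (integers_map f).
Proof.
split=> [|x y]; apply: val_inj.
  by rewrite [RHS]integer_val1 -(rmorph1 f) -integer_val1.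
by rewrite [RHS]integer_valM -(rmorphM f) -integer_valM.
Qed.
HB.instance Definition _ := GRing.isZmodMorphism.Build (integers E) (integers L)
  (integers_map f) integers_map_additive.
HB.instance Definition _ := GRing.isMonoidMorphism.Build (integers E) (integers L)
  (integers_map f) integers_map_multiplicative.

Lemma integers_map_inj : injective (integers_map f).
Proof.
by move=> x y /(congr1 val) e; apply: val_inj; apply: (fmorph_inj f).
Qed.

End IntegersMap.

Lemma map_poly_prod_XsubC (R S : comNzRingType) (f : {rmorphism R -> S}) (zs : seq R) :
  map_poly f (\prod_(z <- zs) ('X - z%:P)) = \prod_(w <- [seq f z | z <- zs]) ('X - w%:P).
Proof.
rewrite rmorph_prod big_map; apply: eq_bigr => z _.
by rewrite rmorphB /= map_polyX map_polyC.
Qed.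

Lemma map_poly_Xn_sub_1 (R S : comNzRingType) (f : {rmorphism R -> S}) n :
  map_poly f ('X^n - 1) = 'X^n - 1.
Proof. by rewrite rmorphB rmorph1 /= map_polyXn. Qed.

Section RootsOfUnity.
Variables (p : nat) (pr : prime p) (L : fieldExtType (Qp pr)).
Local Notation val := (val : {rmorphism integers L -> L}).

Lemma integers_nat_neq0 : p%:R != 0 :> L.
Proof. exact: p_neq0 (Zp_to_inj (E := L)). Qed.

Lemma integers_roots_unity (zs : seq (integers L)) :
  \prod_(z <- zs) ('X - z%:P) = 'X^p - 1 ->
  (forall z, z \in zs -> z ^+ p = 1) /\
  (forall i, (i < p)%N -> \sum_(z <- zs) z ^+ i = (i == 0%N)%:R * p%:R).
Proof.
move=> prodE.
have prodL : \prod_(w <- [seq val z | z <- zs]) ('X - w%:P) = 'X^p - 1.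
  by rewrite -map_poly_prod_XsubC prodE map_poly_Xn_sub_1.
split=> [z zzs|i ip].
  apply: val_inj; rewrite rmorphXn rmorph1; apply/eqP.
  have : root (\prod_(w <- [seq val z | z <- zs]) ('X - w%:P)) (val z).
    by rewrite root_prod_XsubC map_f.
  by rewrite prodL rootE !hornerE subr_eq0.
apply: val_inj; rewrite rmorph_sum rmorphM !rmorph_nat.
rewrite -(sum_roots_unity pr integers_nat_neq0 prodL ip) big_map.
by apply: eq_bigr => z _; rewrite rmorphXn.
Qed.

Lemma roots_unity_exist (z : L) : p.-primitive_root z ->
  exists zs : seq (integers L), \prod_(z <- zs) ('X - z%:P) = 'X^p - 1.
Proof.
move=> zprim.
have zi : z \in @is_integer p pr L.
  apply/asboolP; exists ('X^p - 1); first by rewrite monic_Xn_sub_1 // prime_gt0.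
  apply/rootP; rewrite map_poly_Xn_sub_1 !hornerE.
  by rewrite prim_expr_order // subrr.
exists [seq Integer zi ^+ i | i <- index_iota 0 p].
apply: (map_inj_poly (f := val)); [exact: val_inj|exact: rmorph0|].
rewrite map_poly_Xn_sub_1 map_poly_prod_XsubC -(factor_Xn_sub_1 zprim) !big_map.
by apply: eq_bigr => i _; rewrite rmorphXn.
Qed.

End RootsOfUnity.

(** * The kernel of psi *)

Section Psi.
Variables (p : nat) (pr : prime p) (p_odd : odd p) (E : fieldExtType (Qp pr)).
Local Notation A := (fps (integers E)).
Local Notation u := (1 + fpsX (integers E)).
Let hE := padic_integers E.

Lemma phiE (F : A) : Defs.phi F = fps_subst p F (u ^+ p - 1). Proof. by []. Qed.

Lemma psi_sum (F : A) (G : nat -> A) (L : fieldExtType (Qp pr))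
    (f : {lrmorphism E -> L}) (zs : seq (integers L)) :
  F = \sum_(j < p) u ^+ j * Defs.phi (G j) ->
  \prod_(z <- zs) ('X - z%:P) = 'X^p - 1 ->
  \sum_(z <- zs) fps_subst p (fps_map (integers_map f) F)
                             (fpsC z * (1 + fpsX (integers L)) - 1) =
  p%:R * fps_map (integers_map f) (Defs.phi (G 0%N)).
Proof.
move=> FG /integers_roots_unity[zsp zsum].
have hL := padic_integers L.
have mapu : fps_map (integers_map f) u = 1 + fpsX (integers L).
  by rewrite rmorphD rmorph1 /= fps_mapX.
have mapphi H : fps_map (integers_map f) (Defs.phi H) =
    fps_subst p (fps_map (integers_map f) H) ((1 + fpsX (integers L)) ^+ p - 1).
  rewrite phiE (fps_map_subst _ hE hL); last exact: top_nilp_upow.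
  by rewrite rmorphB rmorphXn rmorph1 /= mapu.
rewrite mapphi -(unity_average pr p_odd hL (fun j => fps_map (integers_map f) (G j)) zsp zsum).
apply: eq_bigr => z _; congr fps_subst; rewrite FG rmorph_sum.
by apply: eq_bigr => j _; rewrite rmorphM rmorphXn /= mapu mapphi.
Qed.

Lemma phi_decomposition (F : A) : exists G : nat -> A,
  (forall j m i, (j < p)%N -> mass p m (G j) i = mass p m.+1 F (j + p * i)) /\
  F = \sum_(j < p) u ^+ j * Defs.phi (G j).
Proof.
have [G [GP FG]] := frob_decomposition pr p_odd hE 1 F; exists G.
move: GP FG; rewrite (expn1 p) => GP FG.
split=> [j m i jp|].
  by rewrite -addn1; apply: GP.
exact: FG.
Qed.

(** Uniqueness cancels p over the integers of L, then uses the injectivity of the extension of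
    coefficients and of phi; existence takes for L the extension by a primitive p-th root of
    unity. *)
Lemma is_psiP (F H : A) (G : nat -> A) :
  F = \sum_(j < p) u ^+ j * Defs.phi (G j) -> is_psi F H <-> H = G 0%N.
Proof.
move=> FG; split.
  move=> [L [f [zs [prodE]]]]; rewrite (psi_sum f FG prodE).
  move=> /eqP; rewrite -subr_eq0 -mulrBr -rmorphB => /eqP e.
  have hL := padic_integers L.
  have e0 : fps_map (integers_map f) (Defs.phi H - Defs.phi (G 0%N)) = 0.
    apply: fps_eqP => m; rewrite fps_coef0; apply: (padic_tf hL).
    by have := congr1 (fun F : fps (integers L) => F m) e; rewrite -fpsC_nat fps_coefCM fps_coef0.
  have e1 : Defs.phi H - Defs.phi (G 0%N) = 0.
    apply: (fps_map_inj (@integers_map_inj _ _ _ _ f)).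
    by rewrite e0 rmorph0.
  have := frob_inj pr p_odd hE (n := 1); rewrite expn1; apply.
  by apply/eqP; rewrite -subr_eq0; apply/eqP.
move=> ->.
have [L [f [z zprim]]] := adjoin_root_unity pr (integers_nat_neq0 E).
have [zs prodE] := roots_unity_exist zprim.
by exists L, f, zs; split=> //; rewrite (psi_sum f FG prodE).
Qed.

Lemma ker_psiP (F : A) : ker_psi E F <-> unit_supported p F.
Proof.
have [G [GP FG]] := phi_decomposition F.
have -> : ker_psi E F <-> G 0%N = 0.
  rewrite /ker_psi /= /psi.
  (* The default value 0 of [psi] would also put F in the kernel; the existence part of [is_psiP]
     excludes this case. *)
  case: xgetP => [H _ /= /(is_psiP _ FG) -> //|/(_ (G 0%N)) none].
  by case: none; apply/(is_psiP _ FG).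
split=> [G0 m i|hF].
  by have := GP 0%N m i (prime_gt0 pr); rewrite G0 (mass0 pr p_odd hE) add0n.
apply: (mass_inj pr p_odd hE (n0 := 0)) => m i _.
by rewrite GP ?prime_gt0 // add0n hF.
Qed.

Lemma iter_phi_X n : iter n (@Defs.phi p pr E) (fpsX (integers E)) = u ^+ (p ^ n) - 1.
Proof.
elim: n => [|n IH]; first by rewrite expr1 addrC addKr.
by rewrite iterS IH phiE (subst_upow_sub1 hE) -expnS.
Qed.

Lemma phin_ker_psiP n (F : A) : (0 < n)%N ->
  phin_ker_psi E n F <-> ker_psi E F /\ forall j, mass p n F j = 0.
Proof.
move=> n0; rewrite ker_psiP -(unit_supported_upow_sub1 pr p_odd hE F n0).
rewrite /phin_ker_psi iter_phi_X; split=> [[H /ker_psiP]|[H /ker_psiP]]; by exists H.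
Qed.

End Psi.

(** * The cyclotomic character *)

Section RestrictAut.
Variables (p : nat) (pr : prime p) (v : {rmorphism algC -> algC}).

Lemma mu_in_Qmu n (z : algC) : z ^+ (p ^ n) = 1 -> z \in in_Qmu p.
Proof. by move=> zn; apply/asboolP => S _; apply; exists n. Qed.

Lemma aut_Qmu (z : algC) : z \in in_Qmu p -> v z \in in_Qmu p.
Proof.
move=> /asboolP hz.
pose S : {pred algC} := fun x => `[< v x \in in_Qmu p >].
have [Q1 QB QD] := in_Qmu_divring p.
suff : z \in S by move/asboolP.
apply: hz => [|y [n yn]].
  split=> [|x y /asboolP xQ /asboolP yQ|x y /asboolP xQ /asboolP yQ]; apply/asboolP.
  - by rewrite rmorph1.
  - by rewrite rmorphB; apply: QB.
  - by rewrite fmorph_div; apply: QD.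
by apply/asboolP; apply: (@mu_in_Qmu n); rewrite -rmorphXn yn rmorph1.
Qed.

(** The image of Q(mu_{p^oo}) is a field containing all p-power roots of unity, because v sends
    primitive roots to primitive roots. *)
Lemma aut_Qmu_surj (z : algC) : z \in in_Qmu p -> exists2 y, y \in in_Qmu p & v y = z.
Proof.
move=> /asboolP hz.
have [Q1 QB QD] := in_Qmu_divring p.
pose S : {pred algC} := fun z => `[< exists2 y, y \in in_Qmu p & v y = z >].
suff : z \in S by move/asboolP.
apply: hz => [|y [n yn]].
  split=> [|_ _ /asboolP[x xQ <-] /asboolP[y yQ <-]|_ _ /asboolP[x xQ <-] /asboolP[y yQ <-]];
    apply/asboolP.
  - by exists 1; [exact: Q1|exact: rmorph1].
  - by exists (x - y); [exact: QB|exact: rmorphB].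
  - by exists (x / y); [exact: QD|exact: fmorph_div].
have pn0 : (0 < p ^ n)%N by rewrite expn_gt0 prime_gt0.
have [w wP] := C_prim_root_exists pn0.
have wP' : (p ^ n).-primitive_root (v w) by rewrite fmorph_primitive_root.
have [i ->] := prim_rootP wP' yn.
apply/asboolP; exists (w ^+ i); last by rewrite rmorphXn.
by apply: (@mu_in_Qmu n); rewrite exprAC (prim_expr_order wP) expr1n.
Qed.

Definition restrict_aut (x : Qmu p) : Qmu p := QmuElt (aut_Qmu (QmuP x)).

Fact restrict_aut_additive : zmod_morphism restrict_aut.
Proof. by move=> x y; apply: val_inj; apply: (rmorphB v). Qed.
Fact restrict_aut_multiplicative : monoid_morphism restrict_aut.
Proof.
by split=> [|x y]; apply: val_inj; [apply: (rmorph1 v)|apply: (rmorphM v)].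
Qed.
HB.instance Definition _ := GRing.isZmodMorphism.Build (Qmu p) (Qmu p)
  restrict_aut restrict_aut_additive.
HB.instance Definition _ := GRing.isMonoidMorphism.Build (Qmu p) (Qmu p)
  restrict_aut restrict_aut_multiplicative.

Lemma restrict_aut_bij : bijective restrict_aut.
Proof.
have surj (x : Qmu p) : exists y, restrict_aut y = x.
  have [y yQ yx] := aut_Qmu_surj (QmuP x).
  by exists (QmuElt yQ); apply: val_inj.
exists (fun x => sval (cid (surj x))) => x; last exact: (svalP (cid (surj x))).
by apply: (fmorph_inj restrict_aut); exact: (svalP (cid (surj _))).
Qed.

Definition Gamma_of_aut : Gamma p := GammaElt restrict_aut_bij.

End RestrictAut.

(** * Gamma / Gamma_n as the group of units modulo p^n *)

Section Cyclotomic.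
Variables (p : nat) (pr : prime p).
Implicit Types s t : Gamma p.
Local Notation ZZ := (Defs.Zp pr).

Lemma Qmu_prim_root n : exists w : Qmu p,
  [/\ w ^+ (p ^ n) = 1, forall x : Qmu p, x ^+ (p ^ n) = 1 -> exists k, x = w ^+ k
    & forall i j, w ^+ i = w ^+ j -> i = j %[mod p ^ n]].
Proof.
have pn0 : (0 < p ^ n)%N by rewrite expn_gt0 prime_gt0.
have [z zP] := C_prim_root_exists pn0.
have zn := prim_expr_order zP; pose w := QmuElt (mu_in_Qmu zn).
exists w; split=> [|x /Qmu_root /(prim_rootP zP)[k xk]|i j].
- exact/Qmu_root.
- by exists k; apply: val_inj; rewrite /= xk Qmu_valX.
move=> /(congr1 (@Qmu_val p)); rewrite !Qmu_valX => /eqP.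
by rewrite (eq_prim_root_expr zP) => /eqP.
Qed.

Lemma chi_exists s : exists a : ZZ, forall k (x : Qmu p),
  x ^+ (p ^ k.+1) = 1 -> s x = x ^+ approx a k.
Proof.
have e k : exists a, forall x : Qmu p, x ^+ (p ^ k.+1) = 1 -> s x = x ^+ a.
  have [w [w1 wP _]] := Qmu_prim_root k.+1.
  have [a ha] := wP (s w) (gal_root s w1); exists a => x /wP[i ->].
  by rewrite rmorphXn ha exprAC.
pose f k := sval (cid (e k)).
have fP k x : x ^+ (p ^ k.+1) = 1 -> s x = x ^+ f k by apply: (svalP (cid (e k))).
have [|a ha] := @Zp_of_seq p pr f.
  move=> k; have [w [w1 _ wi]] := Qmu_prim_root k.+1; apply: wi.
  by rewrite -!fP // expnSr exprM w1 expr1n.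
by exists a => k x xk; rewrite (fP k) // ha (expr_mod _ xk).
Qed.

Lemma chiP s k (x : Qmu p) : x ^+ (p ^ k.+1) = 1 -> s x = x ^+ approx (chi pr s) k.
Proof.
rewrite /chi; case: xgetP => [a _ h|none]; first exact: h.
by have [a /none] := chi_exists s.
Qed.

Lemma approx_modE (a b : ZZ) n : approx a n = approx b n %[mod p ^ n.+1] -> approx a n = approx b n.
Proof. by rewrite !modn_small // approx_lt. Qed.

Lemma chi_eqP s t n : (forall x : Qmu p, x ^+ (p ^ n.+1) = 1 -> s x = t x) <->
  approx (chi pr s) n = approx (chi pr t) n.
Proof.
split=> [h|h x xn]; last by rewrite (chiP s xn) (chiP t xn) h.
have [w [w1 _ wi]] := Qmu_prim_root n.+1.
by apply: approx_modE; apply: wi; rewrite -!chiP // h.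
Qed.

Lemma chiM s t n :
  approx (chi pr (s * t)%g) n = approx (chi pr s) n * approx (chi pr t) n %[mod p ^ n.+1].
Proof.
have [w [w1 _ wi]] := Qmu_prim_root n.+1; apply: wi.
rewrite -chiP // -[(s * t)%g w]/(s (t w)) (chiP t w1) rmorphXn (chiP s w1).
by rewrite exprM.
Qed.

Lemma chi1 n : approx (chi pr 1%g) n = 1 %[mod p ^ n.+1].
Proof.
by have [w [w1 _ wi]] := Qmu_prim_root n.+1; apply: wi; rewrite -chiP ?expr1.
Qed.

Lemma chi_unit s : ~~ (p %| approx (chi pr s) 0)%N.
Proof.
apply/negP => /dvdnP[k hk]; have [w [w1 _ wi]] := Qmu_prim_root 1.
have sw : s w = 1 by rewrite (chiP s w1) hk mulnC -[p in w ^+ (p * k)]expn1 exprM w1 expr1n.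
have w_eq1 : w = 1 by apply: (fmorph_inj s); rewrite sw rmorph1.
have := wi 0%N 1%N; rewrite w_eq1 !expr1n => /(_ erefl).
by rewrite expn1 mod0n modn_small ?prime_gt1.
Qed.

(** The automorphism of [algC] supplied by [Qn_aut_exists], which rests on the irreducibility of
    cyclotomic polynomials, is restricted to Q(mu_{p^oo}). *)
Lemma chi_surj n a : coprime a p -> exists s, approx (chi pr s) n = a %[mod p ^ n.+1].
Proof.
move=> ap; have ap' : coprime a (p ^ n.+1) by rewrite coprimeXr.
have [v hv] := Qn_aut_exists ap'.
exists (Gamma_of_aut pr v); have [w [w1 _ wi]] := Qmu_prim_root n.+1; apply: wi.
rewrite -chiP //; apply: val_inj => /=.
by rewrite Qmu_valX hv //; apply/Qmu_root.
Qed.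

Definition gq_point n (g : Gamma_quot pr n.+1) : nat := approx (chi pr (gq_lift g)) n.

Lemma gq_point_to_quot n s : gq_point (to_quot pr n.+1 s) = approx (chi pr s) n.
Proof. by apply/chi_eqP => x; apply: repr_quotP. Qed.

Lemma gq_point_inj n (g h : Gamma_quot pr n.+1) :
  gq_point g = gq_point h %[mod p ^ n.+1] -> g = h.
Proof.
move=> /approx_modE /chi_eqP e; rewrite -[g]gq_liftK -[h]gq_liftK.
exact/to_quotP.
Qed.

Lemma gq_pointM n (g h : Gamma_quot pr n.+1) :
  gq_point (g * h)%g = gq_point g * gq_point h %[mod p ^ n.+1].
Proof. by rewrite -[(g * h)%g]/(to_quot _ _ _) gq_point_to_quot chiM. Qed.

Lemma gq_point1 n : gq_point (1%g : Gamma_quot pr n.+1) = 1 %[mod p ^ n.+1].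
Proof. by rewrite -[1%g]/(to_quot pr n.+1 1%g) gq_point_to_quot chi1. Qed.

Lemma gq_point_surj n a : ~~ (p %| a)%N ->
  exists g : Gamma_quot pr n.+1, a = gq_point g %[mod p ^ n.+1].
Proof.
rewrite -prime_coprime // coprime_sym => /(chi_surj n)[s hs].
by exists (to_quot pr n.+1 s); rewrite gq_point_to_quot.
Qed.

Lemma gq_trans_point n (g : Gamma_quot pr n.+2) :
  approx (chi pr (gq_lift (gq_trans g))) n = approx (chi pr (gq_lift g)) n.
Proof. by apply/chi_eqP => x; apply: repr_quotP. Qed.

End Cyclotomic.

(** * The action of O[[Gamma]] *)

Section IwasawaAction.
Variables (p : nat) (pr : prime p) (p_odd : odd p).
Variables (R : comNzRingType) (hR : padic_ring p R).
Implicit Types (F G : fps R) (s t : Gamma p).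
Local Notation u := (1 + fpsX R).
Local Notation gamma s F := (fps_subst p F (zpow R (chi pr s) - 1)).
Local Notation Gq n := (Gamma_quot pr n).

Lemma zpow_cong (a b : Defs.Zp pr) n : approx a n = approx b n ->
  inJ p n.+2 (zpow R a - zpow R b).
Proof.
move=> e; apply: inJ_trans (zpow_approx hR a n) _; rewrite e; apply: inJ_sym.
exact: zpow_approx.
Qed.

Lemma mass_zpow_subst_cong (a b : Defs.Zp pr) n F j : approx a n = approx b n ->
  mass p n.+1 (fps_subst p F (zpow R a - 1)) j = mass p n.+1 (fps_subst p F (zpow R b - 1)) j.
Proof.
move=> e; apply: (@fpsC_inj R).
have lin (x : Defs.Zp pr) :
    cont_linear p (fun F => fpsC (mass p n.+1 (fps_subst p F (zpow R x - 1)) j)).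
  have tn := top_nilp_zpow hR x.
  exact: (cont_linear_comp (cont_linear_mass pr p_odd hR n.+1 j) (cont_linear_subst hR tn)).
apply: (cont_linear_eq hR (lin a) (lin b)) => i.
have ta := top_nilp_zpow hR a; have tb := top_nilp_zpow hR b.
rewrite (substXn hR _ _ ta) (substXn hR _ _ tb) (subst_u hR ta) (subst_u hR tb).
by rewrite !(mass_zpowX p_odd hR) e.
Qed.

(* The coefficients of an element of O[[Gamma]]. *)
Variable c : forall n, Gq n -> R.
Hypothesis c_trans : forall n (h : Gq n),
  c h = \sum_(g : Gq n.+1 | gq_trans g == h) c g.

Lemma gq_sum_trans n (y : Gamma p -> fps R) :
  \sum_(h : Gq n) fpsC (c h) * y (gq_lift h) =
  \sum_(g : Gq n.+1) fpsC (c g) * y (gq_lift (gq_trans g)).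
Proof.
rewrite [RHS](partition_big (@gq_trans p pr n) predT) //=; apply: eq_bigr => h _.
rewrite c_trans rmorph_sum mulr_suml; apply: eq_bigr => g /eqP <-.
by [].
Qed.

Definition gq_act F : fps R :=
  fps_lim p (fun n => \sum_(g : Gq n) fpsC (c g) * gamma (gq_lift g) F).

(** Transition maps sum coefficients over their fibres, so the sum of level n can be rewritten over
    level n + 1. Matching terms then involve lifts whose characters agree modulo p^n, and their
    difference is small. *)
Lemma gq_act_cvg F :
  Jcvg p (fun n => \sum_(g : Gq n) fpsC (c g) * gamma (gq_lift g) F) (gq_act F).
Proof.
(* Level 0 is skipped, because the quotient there carries no information on the character. *)
apply: (Jcauchy_cvg hR) => N; exists N.+1 => -[//|n] Nn.
rewrite (gq_sum_trans n.+1 (fun s => gamma s F)) -sumrB; apply: inJ_sum => g _.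
rewrite -mulrBr; apply: inJ_mull.
apply: (subst_cong hR); [exact: top_nilp_zpow|exact: top_nilp_zpow|].
have -> : forall x y z : fps R, x - z - (y - z) = x - y by move=> x y z; ring.
apply: (@inJ_le _ _ _ n.+2); first by apply: leq_trans (leqnSn _) (leqW _).
by apply: zpow_cong; rewrite gq_trans_point.
Qed.

(** Masses modulo p^(n+1) of a translate of F depend only on the character modulo p^(n+1), so the
    masses of the approximating sums are constant from level n + 1 on. *)
Lemma gq_act_mass n F j :
  mass p n.+1 (gq_act F) j =
  \sum_(g : Gq n.+1) c g * mass p n.+1 (gamma (gq_lift g) F) j.
Proof.
apply: (padic_cvg_uniq hR (mass_lim pr p_odd hR n.+1 j (gq_act_cvg F))).
apply: (@padic_cvg_eventually _ _ _ _ n.+1) => m /subnKC <-.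
rewrite (mass_sum pr p_odd hR); under eq_bigr do rewrite (massZ pr p_odd hR).
elim: (m - n.+1)%N => [|k IH]; first by rewrite addn0.
rewrite -{}IH addnS; apply: (@fpsC_inj R); rewrite !rmorph_sum.
pose y s := fpsC (mass p n.+1 (gamma s F) j).
transitivity (\sum_(g : Gq (n.+1 + k).+1) fpsC (c g) * y (gq_lift (gq_trans g))); last first.
  by rewrite -gq_sum_trans; apply: eq_bigr => g _; rewrite rmorphM.
apply: eq_bigr => g _.
have e : approx (chi pr (gq_lift g)) n = approx (chi pr (gq_lift (gq_trans g))) n.
  have /(congr1 (modn^~ (p ^ n.+1)%N)) := gq_trans_point (n := n + k) g.
  by rewrite !approx_mod.
have e' : y (gq_lift g) = y (gq_lift (gq_trans g)).
  exact: (congr1 (@fpsC R) (mass_zpow_subst_cong F j e)).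
by rewrite -e' rmorphM.
Qed.

Lemma gq_act_unit_supported F : unit_supported p F -> unit_supported p (gq_act F).
Proof.
move=> hF; apply: (unit_supported_lim pr p_odd hR (gq_act_cvg F)) => k.
apply: (unit_supported_sum pr p_odd hR) => g _; apply: (unit_supportedZ pr p_odd hR).
exact: (unit_supported_subst p_odd hR (chi_unit pr _) hF).
Qed.

(** Since g moves mass from the point of g^-1 k to that of k, the action on masses is the product of
    the group ring. *)
Lemma gq_act_mass_point n F (k : Gq n.+1) :
  mass p n.+1 (gq_act F) (gq_point k) =
  \sum_(g : Gq n.+1) c g * mass p n.+1 F (gq_point (g^-1 * k)%g).
Proof.
rewrite gq_act_mass; apply: eq_bigr => g _; congr (_ * _).
rewrite -[RHS](mass_zpow_subst p_odd hR (chi_unit pr (gq_lift g))).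
apply: mass_period.
by rewrite -[in LHS](mulKVg g k) gq_pointM.
Qed.

End IwasawaAction.

(** * Cosets as fibres of the mass map *)

Section Points.
Variables (p : nat) (pr : prime p) (p_odd : odd p) (n : nat).
Variables (R : comNzRingType) (hR : padic_ring p R).
Implicit Types (F G : fps R).
Local Notation Gq := (Gamma_quot pr n.+1).

(* The series whose masses on the classes of units mod p^n are prescribed: these
   sets are the cosets of phi^n(pi) A^(psi = 0) in A^(psi = 0). *)
Definition mass_fiber (x : Gq -> R) : set (fps R) :=
  [set F | unit_supported p F /\ forall g, mass p n.+1 F (gq_point g) = x g]%classic.

Lemma unit_supported_points F : unit_supported p F ->
  (forall g : Gq, mass p n.+1 F (gq_point g) = 0) -> forall j, mass p n.+1 F j = 0.
Proof.
move=> hF F0 j; have [/dvdnP[k ->]|pj] := boolP (p %| j)%N; first by rewrite mulnC hF.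
by have [g /mass_period ->] := gq_point_surj pr n pj.
Qed.

(** The witness is the combination of Dirac measures at chi(g), for lifts of g, with weights
    x(g). *)
Lemma mass_fiber_nonempty (x : Gq -> R) : exists F, mass_fiber x F.
Proof.
exists (\sum_(g : Gq) fpsC (x g) * zpow R (chi pr (gq_lift g)) ^+ 1); split=> [|k].
  apply: (unit_supported_sum pr p_odd hR) => g _; apply: (unit_supportedZ pr p_odd hR).
  move=> m j; rewrite (mass_zpowX p_odd hR) muln1; case: eqP => // e.
  have := chi_unit pr (gq_lift g); rewrite -(approx_mod _ 0 m) add0n expn1 /dvdn modn_mod.
  rewrite -(@modn_dvdm (p ^ m.+1)) ?dvdn_exp // e modn_dvdm ?dvdn_exp //.
  by rewrite modnMr eqxx.
rewrite (mass_sum pr p_odd hR) (bigD1 k) //= big1 => [|g gk].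
  by rewrite (massZ pr p_odd hR) (mass_zpowX p_odd hR) muln1 eqxx mulr1 addr0.
rewrite (massZ pr p_odd hR) (mass_zpowX p_odd hR) muln1; case: eqP => [/gq_point_inj e|_].
  by rewrite e eqxx in gk.
by rewrite mulr0.
Qed.

Lemma mass_fiber_inj (x y : Gq -> R) : mass_fiber x = mass_fiber y -> x =1 y.
Proof.
move=> e g; have [F xF] := mass_fiber_nonempty x; have : mass_fiber y F by rewrite -e.
by case: xF => _ <- [_ <-].
Qed.

Lemma mass_fiberD (x y : Gq -> R) :
  coset_add (mass_fiber x) (mass_fiber y) = mass_fiber (fun g => x g + y g).
Proof.
apply/seteqP; split=> [_ [F [hF Fx] [G [hG Gy] <-]]|F [hF Fxy]].
  split=> [|g]; first exact: (unit_supportedD pr p_odd hR hF hG).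
  by rewrite (massD pr p_odd hR) Fx Gy.
have [G [hG Gy]] := mass_fiber_nonempty y.
exists (F - G).
  split=> [|g]; first exact: (unit_supportedB pr p_odd hR hF hG).
  by rewrite (massB pr p_odd hR) Fxy Gy addrK.
by exists G => //; rewrite subrK.
Qed.

Variable N : set (fps R).
Hypothesis NP : forall F, N F <-> unit_supported p F /\ forall j, mass p n.+1 F j = 0.

Lemma mass_fiberB (x : Gq -> R) F G : mass_fiber x F -> mass_fiber x G -> N (F - G).
Proof.
move=> [hF Fx] [hG Gx]; have hFG := unit_supportedB pr p_odd hR hF hG.
apply/NP; split=> //; apply: (unit_supported_points hFG) => g.
by rewrite (massB pr p_odd hR) Fx Gx subrr.
Qed.

Lemma mass_fiber_addN (x : Gq -> R) F H : mass_fiber x F -> N H -> mass_fiber x (F + H).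
Proof.
move=> [hF Fx] /NP[hH H0]; split=> [|g]; first exact: (unit_supportedD pr p_odd hR hF hH).
by rewrite (massD pr p_odd hR) Fx H0 addr0.
Qed.

Lemma mass_fiber_coset (x : Gq -> R) F : mass_fiber x F -> coset_of_sub N F = mass_fiber x.
Proof.
move=> xF; apply/seteqP; split=> [_ [H NH <-]|G xG]; first exact: mass_fiber_addN.
by exists (G - F); [exact: mass_fiberB xG xF | rewrite addrC subrK].
Qed.

(** The action of l is only known to send a fibre into a fibre; the summand from N in [coset_scale]
    fills up the target. *)
Lemma mass_fiber_scale (T : Type) (act : T -> fps R -> fps R) (l : T) (x y : Gq -> R) :
  (forall F, mass_fiber x F -> mass_fiber y (act l F)) ->
  coset_scale act N l (mass_fiber x) = mass_fiber y.
Proof.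
move=> xy; apply/seteqP; split=> [_ [F xF [H NH <-]]|G yG].
  exact: mass_fiber_addN (xy F xF) NH.
have [F xF] := mass_fiber_nonempty x; exists F => //; exists (G - act l F).
  exact: mass_fiberB yG (xy F xF).
by rewrite addrC subrK.
Qed.

End Points.

(** * The action of Lambda on fibres *)

Section LambdaAction.
Variables (p : nat) (pr : prime p) (p_odd : odd p) (E : fieldExtType (Qp pr)).
Implicit Types l : Lambda E.
Let hE := padic_integers E.

Definition Lambda_coef l n (g : Gamma_quot pr n) : integers E := gcoef (to_level n l) g.

Lemma Lambda_coef_trans l n (h : Gamma_quot pr n) :
  Lambda_coef l h = \sum_(g : Gamma_quot pr n.+1 | gq_trans g == h) Lambda_coef l g.
Proof.
rewrite /Lambda_coef {1}/to_level -(componentP l n).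
by rewrite ffunE.
Qed.

Lemma Lambda_actE l F : Lambda_act E l F = gq_act (Lambda_coef l) F.
Proof. by []. Qed.

Lemma Lambda_act_fiber n l (x : Lambda_level E n.+1) F :
  mass_fiber (n := n) x F -> mass_fiber (n := n) (to_level n.+1 l * x) (Lambda_act E l F).
Proof.
move=> [hF Fx]; rewrite Lambda_actE; split=> [|k].
  exact: (gq_act_unit_supported p_odd hE (@Lambda_coef_trans l) hF).
rewrite (gq_act_mass_point p_odd hE (@Lambda_coef_trans l)) ffunE.
by apply: eq_bigr => g _; rewrite Fx.
Qed.

Lemma one_plus_pi_fiber n :
  mass_fiber (n := n) (1 : Lambda_level E n.+1) (1 + fpsX (integers E)).
Proof.
rewrite -[1 + _]expr1; split=> [m j|g]; rewrite (mass_upow pr p_odd hE).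
  case: eqP => // e; have := prime_gt1 pr.
  have : (1 == p * j %[mod p])%N.
    by rewrite -(@modn_dvdm (p ^ m.+1)) ?dvdn_exp // e modn_dvdm ?dvdn_exp.
  by rewrite modnMr => /eqP h p1; rewrite modn_small in h.
rewrite ffunE; congr (_ : bool)%:R; apply/eqP/eqP => [e|->].
  by apply: gq_point_inj; rewrite gq_point1 e.
by rewrite gq_point1.
Qed.

End LambdaAction.

Unset Implicit Arguments.

Theorem theorem2p1 (p : nat) (pr : prime p) (p_odd : odd p)
    (E : fieldExtType (Qp pr)) (n : nat) (n_ge1 : (1 <= n)%N) :
  exists f : Lambda_level E n -> set (fps (integers E)),
  [/\ set_bij [set: Lambda_level E n]%classic
        (cosets (ker_psi E) (phin_ker_psi E n)) f,
      (forall x y : Lambda_level E n, f (x + y) = coset_add (f x) (f y)),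
      (forall (l : Lambda E) (x : Lambda_level E n),
         f (to_level n l * x) =
         coset_scale (Lambda_act E) (phin_ker_psi E n) l (f x)) &
      (forall l : Lambda E,
         f (to_level n l) = coset_of_sub (phin_ker_psi E n) (Mellin l))].
Proof.
(* The level is a successor, matching the convention that the component of index n of a p-adic
   integer is a class modulo p^(n+1). *)
case: n n_ge1 => // n _.
have hE := padic_integers E.
have NP F : phin_ker_psi E n.+1 F <-> unit_supported p F /\ forall j, mass p n.+1 F j = 0.
  by rewrite (phin_ker_psiP p_odd) // (ker_psiP p_odd).
exists (fun x : Lambda_level E n.+1 => mass_fiber (n := n) x); split=> [|x y|l x|l].
- split=> [x _|x y _ _|_ [F /(ker_psiP p_odd) hF <-]].
  + have [F xF] := mass_fiber_nonempty p_odd hE (fun g => gcoef x g).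
    exists F; first by apply/(ker_psiP p_odd); case: xF.
    exact: (mass_fiber_coset p_odd hE NP xF).
  + move=> /(mass_fiber_inj p_odd hE) e; exact: group_ring_eqP.
  + exists (GroupRing [ffun g => mass p n.+1 F (gq_point g)]) => //.
    apply/esym/(mass_fiber_coset p_odd hE NP); split=> // g.
    by rewrite ffunE.
- rewrite (mass_fiberD p_odd hE); congr mass_fiber.
  by apply: funext => g; rewrite ffunE.
- apply/esym/(mass_fiber_scale p_odd hE NP) => F; exact: Lambda_act_fiber.
(* The Mellin transform of l is l acting on 1 + pi, which lies in the fibre of 1; hence it lies in
   the fibre of the image of l. *)
apply/esym/(mass_fiber_coset p_odd hE NP).
have := Lambda_act_fiber p_odd l (one_plus_pi_fiber p_odd E n).
by rewrite mulr1.
Qed.
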